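(* Let $0<l<L$ and let $p_1$, $p_2$ and $a$ be positive constants (on $(0,l)$, $(l,L)$ and $(\alpha,\beta)$ respectively), where $\alpha=l-\beta=\frac{(L-l)\sqrt{p_1}}{\sqrt{p_2}}$ and $0\le\alpha<\beta\le l$. Let $\mathcal A_2$ be the operator defined in the context with these coefficients. Then for $0<\epsilon\le\frac12$ the operators $\lambda^{\epsilon-\frac12}(i\lambda-\mathcal A_2)^{-1}$ are not uniformly bounded with respect to $\lambda\in\mathbb R$, that is, $$\sup_{\lambda\in\mathbb R}\big\|\lambda^{\epsilon-\frac12}(i\lambda-\mathcal A_2)^{-1}\big\|_{\mathcal L(\mathcal H_2)}=+\infty .$$ Thus the polynomial decay rate in the estimate $\|e^{t\mathcal A_2}(u^0,u^1)\|_{\mathcal H_2}\le\frac{M}{(1+t)^2}\|(u^0,u^1)\|_{\mathcal D(\mathcal A_2)}$ (for all $(u^0,u^1)\in\mathcal D(\mathcal A_2)$ and $t\ge0$, with a constant $M>0$) is optimal.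
   Context: All function spaces consist of complex-valued functions; a prime denotes $d/dx$. Let $D_a=a\,\chi_{(\alpha,\beta)}$ on $(0,l)$, where $\chi_{(\alpha,\beta)}$ is the characteristic function of $(\alpha,\beta)$. $H=L^2(0,l)\times L^2(l,L)$ with norm $\|(v_1,v_2)\|_H^2=\int_0^l|v_1|^2dx+\int_l^L|v_2|^2dx$. $V_2=\{(u_1,u_2)\in H^1(0,l)\times H^1(l,L): u_1(l)=u_2(l),\ u_1(0)=0,\ u_2(L)=0\}$ with norm $\|u\|_{V_2}^2=\int_0^l p_1|u_1'|^2dx+\int_l^L p_2|u_2'|^2dx$. $\mathcal H_2=V_2\times H$ with $\|(u,v)\|_{\mathcal H_2}^2=\|u\|_{V_2}^2+\|v\|_H^2$. The operator $\mathcal A_2$ on $\mathcal H_2$ has domain $\mathcal D(\mathcal A_2)$ (with the graph norm) consisting of all $(u,v)=((u_1,u_2),(v_1,v_2))\in\mathcal H_2$ such that $v\in V_2$, $p_1u_1'+D_av_1'\in H^1(0,l)$, $u_2'\in H^1(l,L)$ and $p_1u_1'(l)=p_2u_2'(l)$; and $$\mathcal A_2(u,v)=\big((v_1,v_2),\,((p_1u_1'+D_av_1')',\,(p_2u_2')')\big).$$ It generates a $C_0$-semigroup of contractions $e^{t\mathcal A_2}$ on $\mathcal H_2$, and $i\mathbb R$ is contained in the resolvent set of $\mathcal A_2$. The decay estimate in the claim is the one the paper proves for $e^{t\mathcal A_2}$ under assumptions on the coefficients that include the present constant-coefficient case. *)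

(* Defs.v *)
From mathcomp Require Import all_boot all_order all_algebra.
From mathcomp Require Import complex.
From mathcomp Require Import all_classical all_reals all_analysis.

Set Implicit Arguments.
Unset Strict Implicit.
Unset Printing Implicit Defensive.

Import Order.TTheory GRing.Theory Num.Theory.
Import numFieldTopology.Exports numFieldNormedType.Exports.
Local Open Scope classical_set_scope.
Local Open Scope ring_scope.

(** Complex-valued functions of a real variable.  A class of functions on an
    interval modulo a.e. equality is handled through its representatives
    [R -> R[i]], whose values off the interval are irrelevant. *)

(* The regular module [R[i]^o] makes [cfun R], hence products of copies of it,
   a complex vector space under the pointwise operations. *)
Definition cfun (R : realType) : lmodType R[i] := (R -> R[i]^o : lmodType R[i]).

Definition sqmod (R : realType) (z : R[i]) : R :=
  complex.Re z ^+ 2 + complex.Im z ^+ 2.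

Definition in_L2 (R : realType) (a b : R) (f : cfun R) : Prop :=
  [/\ measurable_fun `]a, b[ (fun x : R => complex.Re (f x)),
      measurable_fun `]a, b[ (fun x : R => complex.Im (f x)) &
      ((\int[@lebesgue_measure R]_(x in `]a, b[) (sqmod (f x))%:E) < +oo)%E].

Definition C1c (R : realType) (a b : R) (phi : R -> R) : Prop :=
  [/\ forall x, derivable phi x 1, continuous (derive1 phi) &
      exists c d : R, [/\ a < c, d < b &
        forall x, x \notin `[c, d] -> phi x = 0]].

(* Real-valued test functions suffice to test a complex-valued function: the
   identity is required of its real and of its imaginary part. *)
Definition is_weak_derive (R : realType) (a b : R) (f g : cfun R) : Prop :=
  forall phi : R -> R, C1c a b phi ->
    (\int[@lebesgue_measure R]_(x in `]a, b[) (complex.Re (f x) * derive1 phi x))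
      = - (\int[@lebesgue_measure R]_(x in `]a, b[) (complex.Re (g x) * phi x)) /\
    (\int[@lebesgue_measure R]_(x in `]a, b[) (complex.Im (f x) * derive1 phi x))
      = - (\int[@lebesgue_measure R]_(x in `]a, b[) (complex.Im (g x) * phi x)).

Definition in_H1 (R : realType) (a b : R) (f : cfun R) : Prop :=
  in_L2 a b f /\ exists2 g, in_L2 a b g & is_weak_derive a b f g.

(* The weak derivative in L^2(a, b); it is unique a.e. on ]a, b[, and the
   value is meaningful only if such a derivative exists. *)
Definition weak_derive (R : realType) (a b : R) (f : cfun R) : cfun R :=
  xget 0 [set g | in_L2 a b g /\ is_weak_derive a b f g].

(* [f] takes the boundary value [c] at the endpoint [x] of ]a, b[: [c] is the
   essential limit of [f] at [x] from inside the interval.  When [f] is H^1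
   near [x] this is the value at [x] of its continuous representative. *)
Definition has_trace (R : realType) (a b : R) (f : cfun R) (x : R) (c : R[i])
    : Prop :=
  forall e : R, 0 < e -> exists2 d : R, 0 < d &
    {ae @lebesgue_measure R,
      forall y : R, a < y < b -> `|y - x| < d -> sqmod (f y - c) < e ^+ 2}.

(** Operators in a seminormed space.  A normed space is given by a vector
    space [X] of representatives, the set [E] of those which represent a
    vector, and a seminorm [N] on [E]; [U] and [W] represent the same vector
    when [N (U - W) = 0].  An unbounded operator is given by its domain [D]
    and by a map [A] sending representatives to representatives. *)

(* The graph of (z - A)^-1.  If [z] belongs to the resolvent set of [A], it is
   the graph of a bounded operator defined on the whole space. *)
Definition resolvent_graph (R : realType) (X : lmodType R[i]) (E : set X)
    (N : X -> R) (D : set X) (A : X -> X) (z : R[i]) : set (X * X) :=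
  [set FU | [/\ E FU.1, D FU.2 & N (z *: FU.2 - A FU.2 - FU.1) = 0]].

(* Operator norm of the operator with graph [G]. *)
Definition opnorm (R : realType) (X : lmodType R[i]) (N : X -> R)
    (G : set (X * X)) : \bar R :=
  ereal_sup [set (N FU.2)%:E | FU in G `&` [set FU | N FU.1 <= 1]].

Definition contraction_C0_semigroup (R : realType) (X : lmodType R[i])
    (E : set X) (N : X -> R) (T : R -> X -> X) : Prop :=
  [/\ forall t U, 0 <= t -> E U -> E (T t U) /\ N (T t U) <= N U,
      forall t (c : R[i]) U W, 0 <= t -> E U -> E W ->
        N (T t (c *: U + W) - (c *: T t U + T t W)) = 0,
      forall U, E U -> N (T 0 U - U) = 0,
      forall s t U, 0 <= s -> 0 <= t -> E U ->
        N (T (s + t) U - T s (T t U)) = 0 &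
      forall U, E U -> N (T t U - U) @[t --> 0^'+] --> (0 : R)].

Definition generates (R : realType) (X : lmodType R[i]) (E : set X)
    (N : X -> R) (D : set X) (A : X -> X) (T : R -> X -> X) : Prop :=
  forall U W, E U -> E W ->
    (D U /\ N (A U - W) = 0) <->
    (N ((h^-1)%:C%C *: (T h U - U) - W) @[h --> 0^'+] --> (0 : R)).

(* ||T(t) U|| <= M (1 + t)^-gamma ||U||_D(A) on the domain, with the graph norm
   ||U|| + ||A U||. *)
Definition decay_estimate (R : realType) (X : lmodType R[i])
    (N : X -> R) (D : set X) (A : X -> X) (T : R -> X -> X) (gamma : R)
    : Prop :=
  exists2 M : R, 0 < M & forall U t, D U -> 0 <= t ->
    N (T t U) <= M / (1 + t) `^ gamma * (N U + N (A U)).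

(** The transmission problem on ]0, l[ and ]l, L[. *)

(* ((u1, u2), (v1, v2)) *)
Definition state (R : realType) : lmodType R[i] :=
  ((cfun R * cfun R) * (cfun R * cfun R) : lmodType R[i])%type.

Definition in_H (R : realType) (l L : R) (v : cfun R * cfun R) : Prop :=
  in_L2 0 l v.1 /\ in_L2 l L v.2.

Definition in_V2 (R : realType) (l L : R) (u : cfun R * cfun R) : Prop :=
  [/\ in_H1 0 l u.1, in_H1 l L u.2,
      exists2 c, has_trace 0 l u.1 l c & has_trace l L u.2 l c,
      has_trace 0 l u.1 0 0 & has_trace l L u.2 L 0].

Definition in_H2 (R : realType) (l L : R) : set (state R) :=
  [set U | in_V2 l L U.1 /\ in_H l L U.2].

Definition norm_H2 (R : realType) (l L p1 p2 : R) (U : state R) : R :=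
  Num.sqrt (
    (\int[@lebesgue_measure R]_(x in `]0, l[)
       (p1 * sqmod (weak_derive 0 l U.1.1 x)))
    + (\int[@lebesgue_measure R]_(x in `]l, L[)
       (p2 * sqmod (weak_derive l L U.1.2 x)))
    + (\int[@lebesgue_measure R]_(x in `]0, l[) sqmod (U.2.1 x))
    + (\int[@lebesgue_measure R]_(x in `]l, L[) sqmod (U.2.2 x))).

(* D_a = a chi_(alpha, beta) *)
Definition damping (R : realType) (a alpha beta : R) (x : R) : R :=
  a * \1_(`]alpha, beta[%classic : set R) x.

(* p1 u1' + D_a v1' *)
Definition stress (R : realType) (l p1 a alpha beta : R) (u1 v1 : cfun R)
    : cfun R :=
  fun x => p1%:C%C * weak_derive 0 l u1 x
           + (damping a alpha beta x)%:C%C * weak_derive 0 l v1 x.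

Definition domA2 (R : realType) (l L p1 p2 a alpha beta : R)
    : set (state R) :=
  [set U | [/\ in_H2 l L U, in_V2 l L U.2,
      in_H1 0 l (stress l p1 a alpha beta U.1.1 U.2.1),
      in_H1 l L (weak_derive l L U.1.2) &
      exists2 c, has_trace 0 l (p1%:C%C *: weak_derive 0 l U.1.1) l c
               & has_trace l L (p2%:C%C *: weak_derive l L U.1.2) l c]].

Definition A2 (R : realType) (l L p1 p2 a alpha beta : R) (U : state R)
    : state R :=
  (U.2, (weak_derive 0 l (stress l p1 a alpha beta U.1.1 U.2.1),
         weak_derive l L (p2%:C%C *: weak_derive l L U.1.2))).

(* Main.v *)
(** At high frequency the Kelvin-Voigt region acts on the wave in the undamped
    interval ]0, alpha[ almost like a Dirichlet wall: the wave enters it only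
    through a boundary layer of width lambda^(-1/2).  Let lambda = sqrt(p1) k
    with k alpha a multiple of 2 pi, and let u be sin(k x) + delta x cos(k x) on
    ]0, alpha[, a decaying exponential times a cutoff on ]alpha, beta[, and 0
    beyond beta, where delta = O(lambda^(-1/2)) makes the stress continuous at
    alpha.  Then U = (u, i lambda u) lies in the domain, and
    (i lambda - A) U is O(lambda^(-1/2)) relative to U, so that the resolvent at
    i lambda has norm at least of order lambda^(1/2).

    For a contraction semigroup T generated by A, the function
    t |-> ||T(t) U - e^(i lambda t) U|| is subadditive and its slope at 0 is
    ||(A - i lambda) U||.  Hence T(t) U keeps half of its norm up to a time of
    order lambda^(1/2), whereas a decay like t^(-gamma) on the domain bounds it
    at that time by a multiple of lambda^(1 - gamma/2) times ||U||. *)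

Require Import Defs.
From mathcomp Require Import all_boot all_order all_algebra.
From mathcomp Require Import complex.
From mathcomp Require Import all_classical all_reals all_analysis.
From mathcomp Require Import measurable_realfun.
From mathcomp Require Import ring lra.
Import Order.TTheory GRing.Theory Num.Theory.
Import numFieldTopology.Exports numFieldNormedType.Exports.
Local Open Scope classical_set_scope.
Local Open Scope ring_scope.
Set Implicit Arguments.
Unset Strict Implicit.
Unset Printing Implicit Defensive.

(** Origin of the exponents: take lambda = 2 a s^2 and r = (1 + i) s, so that a r^2 = i lambda. The
    balance of stress at alpha reads p1 (k + delta) = - (p1 + i lambda a) r alpha delta. Its right
    side has size lambda^(3/2) |delta|, hence delta has size lambda^(-1/2). On ]0, alpha[ the term
    delta x cos (k x) is resonant and leaves only 2 p1 k delta sin (k x); in the layer the large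
    factor p1 + i lambda a meets the small amplitude alpha delta and derivatives of the cutoff. Both
    residuals have order lambda |delta|, that is lambda^(1/2), against an energy norm of order
    lambda. The first derivative of the cutoff also carries a factor r, which is harmless only
    because that derivative vanishes at alpha, where the exponential is not small.

    The obstacle on the formal side is that [weak_derive] is a representative selected by choice, so
    no derivative of an explicit profile can be read off pointwise. The a.e. uniqueness of weak
    derivatives, hence the fundamental lemma of the calculus of variations, links the profiles to
    the operator and to the norm. *)

(** * Continuously differentiable functions *)

(** The derivative is an explicit argument: the calculus rules build one formula, and [C1_derive_eq]
    replaces it by the intended one. *)
Definition C1_derive (R : realType) (f f' : R -> R) : Prop :=
  (forall x, is_derive x (1 : R) f (f' x)) /\ continuous f'.

Section C1_derive_theory.
Context {R : realType}.
Implicit Types f g : R -> R.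

Lemma C1_derive_continuous f f' : C1_derive f f' -> continuous f.
Proof.
move=> [df _] x; apply: differentiable_continuous.
by apply/derivable1_diffP; apply: ex_derive.
Qed.

Lemma C1_derive1 f f' : C1_derive f f' -> derive1 f = f'.
Proof. by move=> [df _]; apply/funext => x; rewrite derive1E derive_val. Qed.

Lemma C1_derive_eq f f' g' : (forall x, f' x = g' x) ->
  C1_derive f f' -> C1_derive f g'.
Proof. by move=> /funext ->. Qed.

Lemma C1_derive_cst (c : R) : C1_derive (fun=> c) (fun=> 0).
Proof. by split=> [x|x]; [exact: is_derive_cst | exact: cvg_cst]. Qed.

Lemma C1_derive_id : C1_derive (fun x : R => x) (fun=> 1).
Proof. by split=> [x|x]; [exact: is_derive_id | exact: cvg_cst]. Qed.

Lemma C1_deriveD f f' g g' : C1_derive f f' -> C1_derive g g' ->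
  C1_derive (fun x => f x + g x) (fun x => f' x + g' x).
Proof.
move=> [df cf] [dg cg]; split=> [x|x]; first exact: is_deriveD.
by apply: cvgD; [exact: cf | exact: cg].
Qed.

Lemma C1_deriveN f f' : C1_derive f f' ->
  C1_derive (fun x => - f x) (fun x => - f' x).
Proof.
move=> [df cf]; split=> [x|x]; first exact: is_deriveN.
by apply: cvgN; exact: cf.
Qed.

Lemma C1_deriveB f f' g g' : C1_derive f f' -> C1_derive g g' ->
  C1_derive (fun x => f x - g x) (fun x => f' x - g' x).
Proof. by move=> df dg; apply: C1_deriveD => //; exact: C1_deriveN. Qed.

Lemma C1_deriveM f f' g g' : C1_derive f f' -> C1_derive g g' ->
  C1_derive (fun x => f x * g x) (fun x => f' x * g x + f x * g' x).
Proof.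
move=> Cf Cg; have cf := C1_derive_continuous Cf.
have cg := C1_derive_continuous Cg; case: Cf Cg => [df cf'] [dg cg'].
split=> [x|x].
  have -> : f' x * g x + f x * g' x = f x *: g' x + g x *: f' x.
    by rewrite addrC [f' x * _]mulrC.
  exact: is_deriveM.
by apply: cvgD; apply: cvgM; [exact: cf'|exact: cg|exact: cf|exact: cg'].
Qed.

Lemma C1_derive_comp f f' g g' : C1_derive f f' -> C1_derive g g' ->
  C1_derive (fun x => f (g x)) (fun x => f' (g x) * g' x).
Proof.
move=> Cf Cg; have cg := C1_derive_continuous Cg.
case: Cf Cg => [df cf'] [dg cg']; split=> [x|x].
  exact: (@is_derive1_comp _ f g).
by apply: cvgM; [apply: continuous_comp; [exact: cg|exact: cf']|exact: cg'].
Qed.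

Lemma C1_derive_sin : C1_derive (@sin R) cos.
Proof. by split=> [x|]; [exact: is_derive_sin | exact: continuous_cos]. Qed.

Lemma C1_derive_cos : C1_derive (@cos R) (fun x => - sin x).
Proof.
split=> [x|x]; first exact: is_derive_cos.
by apply: cvgN; exact: continuous_sin.
Qed.

Lemma C1_derive_expR : C1_derive (@expR R) expR.
Proof. by split=> [x|]; [exact: is_derive_expR | exact: continuous_expR]. Qed.

(** The building block of compactly supported test functions: squaring removes the corner of the
    positive part. *)
Lemma C1_derive_sqr_pos_part :
  C1_derive (fun x : R => Num.max x 0 ^+ 2) (fun x => 2 * Num.max x 0).
Proof.
split=> [x|x]; last first.
  apply: cvgMr; apply: (@continuous_max _ _ (fun x : R => x) (cst 0)) => //.
  exact: cvg_cst.
have [x0|x0|->] := ltgtP x 0.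
- rewrite mulr0.
  apply: (@near_eq_is_derive _ _ _ (cst (0 : R))).
  near=> y; rewrite /= max_r ?expr0n //.
  by apply/ltW; near: y; exact: lt_nbhsl.
- apply: (@near_eq_is_derive _ _ _ (fun y : R => y ^+ 2)).
    near=> y; rewrite /= max_l //.
    by apply/ltW; near: y; exact: lt_nbhsr.
  suff <- : (2%:R * x ^+ 1) *: (1 : R^o) = 2 * x.
    exact: (@is_deriveX _ _ _ 2 x 1).
  by rewrite /GRing.scale /= expr1 mulr1.
- rewrite mulr0.
  (* At 0 the difference quotient is max(h, 0)^2 / h, of modulus at most |h|. *)
  suff H : h^-1 *: (Num.max (h *: (1:R) + 0) 0 ^+ 2 - Num.max 0 0 ^+ 2)
     @[h --> 0^'] --> (0 : R).
    split; first by apply/cvg_ex; exists 0.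
    by rewrite /derive; apply/cvg_lim => //; exact: Rhausdorff.
  have cn : `|h| @[h --> (0:R)^'] --> (0 : R).
    have h0 := @norm_continuous _ R^o 0; rewrite /continuous_at normr0 in h0.
    exact: cvg_within_filter h0.
  apply/norm_cvg0P; apply: (squeeze_cvgr _ _ cn); last exact: cvg_cst.
  near=> h; rewrite normr_ge0 /= maxxx expr0n subr0 addr0 /GRing.scale /= mulr1.
  have h0 : h != 0 by near: h; exact: nbhs_dnbhs_neq.
  rewrite normrM normfV normrX ler_pdivrMl ?normr_gt0 // -expr2.
  rewrite lerXn2r ?nnegrE ?normr_ge0 // ger0_norm ?le_max ?lexx ?orbT //.
  by rewrite ge_max ler_norm normr_ge0.
Unshelve. all: by end_near. Qed.

End C1_derive_theory.

Lemma C1_deriveX (R : realType) (f f' : R -> R) n : C1_derive f f' ->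
  exists g, C1_derive (fun x => f x ^+ n) g.
Proof.
move=> df; elim: n => [|n [g dg]].
  by exists (fun=> 0); exact: C1_derive_cst.
exists (fun x => f' x * f x ^+ n + f x * g x).
rewrite (_ : (fun x => _) = (fun x => f x * f x ^+ n)); first exact: C1_deriveM.
by apply/funext => x; rewrite exprS.
Qed.

(** * The fundamental lemma of the calculus of variations *)

Section indicator_approximation.
Context {R : realType}.
Variables c d : R.
Hypothesis cd : c < d.

(** Both positive parts are squared to be C1 at [c] and [d]. On the interval each is at most
    [d - c], so the last factor normalizes the values to [0, 1]. *)
Let bump x : R :=
  Num.max (x - c) 0 ^+ 2 * Num.max (d - x) 0 ^+ 2 * (d - c) ^- 4.

Let step n x := 1 - (1 - bump x) ^+ n.

Let C1_bump : exists g, C1_derive bump g.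
Proof.
have Cl : C1_derive (fun x : R => x - c) (fun=> 1 - 0).
  by apply: C1_deriveB; [exact: C1_derive_id | exact: C1_derive_cst].
have Cr : C1_derive (fun x : R => d - x) (fun=> 0 - 1).
  by apply: C1_deriveB; [exact: C1_derive_cst | exact: C1_derive_id].
eexists; apply: C1_deriveM; last exact: C1_derive_cst.
apply: C1_deriveM.
  exact: (C1_derive_comp C1_derive_sqr_pos_part Cl).
exact: (C1_derive_comp C1_derive_sqr_pos_part Cr).
Qed.

Let bump_ge0 x : 0 <= bump x.
Proof.
by apply: mulr_ge0; [apply: mulr_ge0|rewrite invr_ge0]; exact: exprn_even_ge0.
Qed.

Let bump_le1 x : bump x <= 1.
Proof.
have dc0 : 0 < d - c by rewrite subr_gt0.
rewrite ler_pdivrMr ?exprn_gt0 // mul1r -exprMn -[4%N]/(2 * 2)%N exprM.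
rewrite lerXn2r ?nnegrE ?exprn_ge0 ?(ltW dc0) //.
  by rewrite mulr_ge0 // le_max lexx orbT.
rewrite expr2.
have [xc|cx] := leP (x - c) 0; first by rewrite mul0r mulr_ge0 // ltW.
have [xd|dx] := leP (d - x) 0; first by rewrite mulr0 mulr_ge0 // ltW.
by apply: ler_pM; rewrite ?(ltW cx) ?(ltW dx) //; lra.
Qed.

Let bump_out x : x \notin `]c, d[ -> bump x = 0.
Proof.
rewrite in_itv /= negb_and -!leNgt /bump => /orP[xc|dx].
  by rewrite (@max_r _ _ (x - c)) ?subr_le0 // expr0n !mul0r.
by rewrite (@max_r _ _ (d - x)) ?subr_le0 // expr0n mulr0 mul0r.
Qed.

Let bump_in x : x \in `]c, d[ -> 0 < bump x.
Proof.
rewrite in_itv /= => /andP[cx xd].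
by rewrite !mulr_gt0 ?invr_gt0 ?exprn_gt0 // ?lt_max ?subr_gt0 ?cx ?xd.
Qed.

(* The powers [(1 - bump)^n] vanish in the limit exactly where [bump > 0],
   so that [1 - (1 - bump)^n] tends to the indicator of ]c, d[. *)
Lemma C1c_indicator_approximation (a b : R) : a < c -> d < b ->
  exists phi : nat -> R -> R,
    [/\ forall n, C1c a b (phi n), forall n x, `|phi n x| <= 1 &
        forall x, phi n x @[n --> \oo] --> (\1_`]c, d[ x : R)].
Proof.
move=> ac db; exists step; split=> [n|n x|x].
- have [g Cg] := C1_bump.
  have [h Ch] := C1_deriveX n (C1_deriveB (C1_derive_cst 1) Cg).
  have Cs := C1_deriveB (C1_derive_cst 1) Ch.
  split=> [x||].
  + by case: Cs => /(_ x) [].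
  + by rewrite (C1_derive1 Cs); case: Cs.
  + exists c, d; split=> // x xcd; rewrite /step bump_out ?subr0 ?expr1n ?subrr //.
    by apply: contra xcd; rewrite !in_itv /= => /andP[/ltW -> /ltW ->].
- have b0 : 0 <= 1 - bump x by rewrite subr_ge0.
  have b1 : 1 - bump x <= 1 by rewrite gerBl.
  rewrite ger0_norm /step ?gerBl ?exprn_ge0 //.
  by rewrite subr_ge0 exprn_ile1.
- rewrite indicE; case: (boolP (x \in `]c, d[)) => xcd.
    rewrite mem_set // -[X in _ --> X]subr0; apply: cvgB; first exact: cvg_cst.
    apply: cvg_expr; rewrite ger0_norm ?subr_ge0 //.
    by rewrite gtrBl bump_in.
  rewrite memNset; last exact/negP.
  rewrite [X in X @ _](_ : _ = cst 0); first exact: cvg_cst.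
  by apply/funext => n; rewrite /step bump_out // subr0 expr1n subrr.
Qed.

End indicator_approximation.

Section fundamental_lemma.
Context {R : realType}.
Notation mu := (@lebesgue_measure R).
Variables (a b : R) (g : R -> R).
Hypothesis gi : mu.-integrable `]a, b[ (EFin \o g).
Hypothesis g0 : forall phi, C1c a b phi ->
  \int[mu]_(x in `]a, b[) (g x * phi x) = 0.

Let mI : measurable (`]a, b[ : set (measurableTypeR R)). Proof. exact: measurable_itv. Qed.

Let mg : measurable_fun (`]a, b[ : set (measurableTypeR R)) g.
Proof. by apply/measurable_EFinP; exact: measurable_int gi. Qed.

(** The indicator of ]c, d[ is a pointwise limit of test functions bounded by 1; dominated
    convergence with majorant |g| passes to the limit. *)
Let Rintegral_subitv c d : a < c -> c < d -> d < b ->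
  \int[mu]_(x in `]c, d[) g x = 0.
Proof.
move=> ac cd db.
have [phi [Cphi phi1 phi_cvg]] := C1c_indicator_approximation cd ac db.
have mphi n : measurable_fun (`]a, b[ : set (measurableTypeR R)) (phi n).
  apply: (@measurable_funS _ _ _ _ setT) => //.
  apply: continuous_measurable_fun => x.
  by apply/differentiable_continuous/derivable1_diffP; case: (Cphi n).
have H : (\int[mu]_(x in `]a, b[) (g x * phi n x)%:E)%E @[n --> \oo]
    --> (\int[mu]_(x in `]a, b[) (g x * \1_`]c, d[ x)%:E)%E.
  have [|||||_ _ //] := @dominated_convergence _ _ R mu `]a, b[ mI
    (fun n x => (g x * phi n x)%:E) (fun x => (g x * \1_`]c, d[ x)%:E)
    (fun x => `|(g x)%:E|%E).
  - by move=> n; apply/measurable_EFinP; exact: (measurable_funM mg (mphi _)).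
  - by apply/measurable_EFinP; apply: (measurable_funM mg); exact: measurable_indic.
  - apply: aeW => x _; apply: cvg_EFin; first exact: nearW.
    by apply: cvgM; [exact: cvg_cst | exact: phi_cvg].
  - exact: integrable_abse.
  - by apply: aeW => x n _; rewrite /= lee_fin normrM ler_piMr.
have e n : (\int[mu]_(x in `]a, b[) (g x * phi n x)%:E = 0)%E.
  rewrite -[LHS]fineK ?[X in X%:E](g0 (Cphi n)) //.
  apply: integrable_fin_num => //.
  apply: (@le_integrable _ _ _ mu _ mI _ (EFin \o g)) => //.
    by apply/measurable_EFinP; exact: (measurable_funM mg (mphi _)).
  by move=> x _; rewrite /= lee_fin normrM ler_piMr.
have {}e : (fun n => \int[mu]_(x in `]a, b[) (g x * phi n x)%:E)%E = cst 0%E.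
  exact/funext.
rewrite e in H.
have := cvg_unique _ H (@cvg_cst _ _ _ _ _) => /(_ (@ereal_hausdorff R)) H0.
rewrite /Rintegral [X in fine X](_ : _ = 0%E) // -{}H0.
rewrite [in RHS](_ : (fun x => _) = (EFin \o g) \_ `]c, d[); last first.
  apply/funext => x; rewrite patchE indicE.
  by case: ifPn => /=; rewrite ?mulr1 ?mulr0.
rewrite -integral_mkcondr (_ : _ `&` _ = `]c, d[%classic) //.
apply/setIidPr => x /=; rewrite !in_itv /= => /andP[cx xd].
by rewrite (lt_trans ac cx) (lt_trans xd db).
Qed.

(** A primitive of [g] is constant on ]a, b[ because the integrals over subintervals vanish, and by
    Lebesgue differentiation its derivative is [g] almost everywhere. *)
Lemma ae_eq0_of_C1c : {ae mu, forall x, a < x < b -> g x = 0}.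
Proof.
(* The primitive in [FTC1Ny] starts at -oo, so [g] is extended by zero. *)
pose h := g \_ `]a, b[.
have hi : mu.-integrable setT (EFin \o h).
  have := (@integrable_mkcond _ _ _ mu _ (EFin \o g) mI).1 gi.
  by rewrite restrict_EFin.
have hiI (I : interval R) : mu.-integrable [set` I] (EFin \o h).
  by apply: integrableS hi => //; exact: measurable_itv.
have := @FTC1Ny R h (fun y => hiI _) (open_integrable_locally openT hi).
apply: filterS; first exact: (ae_filter_ringOfSetsType mu).
move=> x /= [_ Fx] /andP[ax xb].
have <- : h x = g x by rewrite /h patchE mem_set //= in_itv /= ax xb.
rewrite -Fx.
pose F y := \int[mu]_(t in `]-oo, y]) h t.
have Fcst y z : a < y -> y < z -> z < b -> F z = F y.
  move=> ay yz zb; apply/eqP; rewrite -subr_eq0; apply/eqP.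
  have yzb : (BRight y <= BRight z)%O by rewrite bnd_simp ltW.
  rewrite [LHS](Rintegral_itvB (hiI _)) //.
  rewrite -Rintegral_itv_bndo_bndc; last exact: hiI.
  rewrite -(Rintegral_subitv ay yz zb); apply: eq_Rintegral => t.
  rewrite inE /= in_itv /= => /andP[yt tz].
  by rewrite /h patchE mem_set //= in_itv /= (lt_trans ay yt) (lt_trans tz zb).
have -> : derive1 (fun y => \int[mu]_(t in `]-oo, y]) h t) x = derive1 (cst (F x)) x.
  rewrite !derive1E; apply: near_eq_derive.
  near=> y; rewrite -/(F y) /=.
  have ay : a < y by near: y; exact: lt_nbhsr.
  have yb : y < b by near: y; exact: lt_nbhsl.
  have [yx|xy|-> //] := ltgtP y x; first by rewrite (Fcst y x).
  by rewrite (Fcst x y).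
by rewrite derive1_cst.
Unshelve. all: by end_near. Qed.

End fundamental_lemma.

(** * Square-integrable complex functions *)

Section complex_parts.
Context {R : rcfType}.
Implicit Types x y : R[i].

Lemma ReD x y : complex.Re (x + y) = complex.Re x + complex.Re y.
Proof. by case: x; case: y. Qed.

Lemma ImD x y : complex.Im (x + y) = complex.Im x + complex.Im y.
Proof. by case: x; case: y. Qed.

Lemma ReB x y : complex.Re (x - y) = complex.Re x - complex.Re y.
Proof. by case: x; case: y. Qed.

Lemma ImB x y : complex.Im (x - y) = complex.Im x - complex.Im y.
Proof. by case: x; case: y. Qed.

Lemma ReM x y : complex.Re (x * y) =
  complex.Re x * complex.Re y - complex.Im x * complex.Im y.
Proof. by case: x; case: y. Qed.

Lemma ImM x y : complex.Im (x * y) =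
  complex.Re x * complex.Im y + complex.Im x * complex.Re y.
Proof. by case: x => ? ?; case: y => ? ?. Qed.

Lemma eq_complexP x y :
  complex.Re x = complex.Re y -> complex.Im x = complex.Im y -> x = y.
Proof. by case: x => ? ?; case: y => ? ? /= -> ->. Qed.

End complex_parts.

Section sqmod_theory.
Context {R : realType}.
Implicit Types x y : R[i].

Lemma sqmod_ge0 x : 0 <= sqmod x.
Proof. by rewrite addr_ge0 ?sqr_ge0. Qed.

Lemma sqmodM x y : sqmod (x * y) = sqmod x * sqmod y.
Proof. by rewrite /sqmod ReM ImM; ring. Qed.

Lemma sqmod0 : sqmod (0 : R[i]) = 0.
Proof. by rewrite /sqmod /=; ring. Qed.

Lemma sqmodN x : sqmod (- x) = sqmod x.
Proof. by case: x => x1 x2; rewrite /sqmod /=; ring. Qed.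

(** Young's inequality with a free weight. It integrates termwise, and [sqrt_subadditive] then
    optimizes the weight, which gives the triangle inequality of the energy norm. *)
Lemma sqmodD_le (s : R) x y : 0 < s ->
  sqmod (x + y) <= (1 + s) * sqmod x + (1 + s^-1) * sqmod y.
Proof.
move=> s0; rewrite /sqmod ReD ImD.
set x1 := complex.Re x; set x2 := complex.Im x.
set y1 := complex.Re y; set y2 := complex.Im y.
rewrite -subr_ge0.
have -> : (1 + s) * (x1 ^+ 2 + x2 ^+ 2) + (1 + s^-1) * (y1 ^+ 2 + y2 ^+ 2) -
  ((x1 + y1) ^+ 2 + (x2 + y2) ^+ 2) =
  s^-1 * ((s * x1 - y1) ^+ 2 + (s * x2 - y2) ^+ 2) by field; rewrite gt_eqF.
by apply: mulr_ge0; [rewrite invr_ge0 ltW | rewrite addr_ge0 ?sqr_ge0].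
Qed.

Lemma sqmodD_le2 x y : sqmod (x + y) <= 2 * sqmod x + 2 * sqmod y.
Proof. by have := sqmodD_le x y ltr01; rewrite invr1. Qed.

Lemma sqr_Re_le x : complex.Re x ^+ 2 <= sqmod x.
Proof. by rewrite lerDl sqr_ge0. Qed.

Lemma sqr_Im_le x : complex.Im x ^+ 2 <= sqmod x.
Proof. by rewrite lerDr sqr_ge0. Qed.

(** On a bounded interval this makes square-integrable functions integrable. *)
Lemma normr_Re_le x : `|complex.Re x| <= 1 + sqmod x.
Proof.
apply: (@le_trans _ _ (1 + complex.Re x ^+ 2)); last by rewrite lerD2l sqr_Re_le.
by rewrite -[_ ^+ 2]real_normK ?num_real //; set t := `|_|; nra.
Qed.

Lemma normr_Im_le x : `|complex.Im x| <= 1 + sqmod x.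
Proof.
apply: (@le_trans _ _ (1 + complex.Im x ^+ 2)); last by rewrite lerD2l sqr_Im_le.
by rewrite -[_ ^+ 2]real_normK ?num_real //; set t := `|_|; nra.
Qed.

End sqmod_theory.

Section ae_lebesgue.
Context {R : realType}.
Notation mu := (@lebesgue_measure R).
Implicit Types P Q S : R -> Prop.

Lemma aeS P Q : (forall x, P x -> Q x) ->
  {ae mu, forall x, P x} -> {ae mu, forall x, Q x}.
Proof. by apply: filterS; exact: (ae_filter_ringOfSetsType mu). Qed.

Lemma aeS2 P Q S : (forall x, P x -> Q x -> S x) ->
  {ae mu, forall x, P x} -> {ae mu, forall x, Q x} -> {ae mu, forall x, S x}.
Proof. by apply: filterS2; exact: (ae_filter_ringOfSetsType mu). Qed.

End ae_lebesgue.

Section L2.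
Context {R : realType}.
Notation mu := (@lebesgue_measure R).
Variables a b : R.
Implicit Types f g : cfun R.
Local Notation I := (`]a, b[%classic : set (measurableTypeR R)).

Let mI : measurable I. Proof. exact: measurable_itv. Qed.

Lemma integrable_cst_oo (k : R) : mu.-integrable I (EFin \o cst k).
Proof.
apply: (@measurable_bounded_integrable _ _ _ mu _ _ mI).
- by rewrite /= lebesgue_measure_itv /=; case: ifP => // _; rewrite -EFinB ltry.
- exact: measurable_cst.
- by exists `|k|; split; [exact: num_real | move=> M kM x _; exact: ltW].
Qed.

Lemma measurable_sqmod f : measurable_fun I (fun x => complex.Re (f x)) ->
  measurable_fun I (fun x => complex.Im (f x)) ->
  measurable_fun I (fun x => sqmod (f x)).
Proof.
by move=> mR mJ; apply: measurable_funD; exact: measurable_funX.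
Qed.

Lemma in_L2_integrable f : in_L2 a b f ->
  mu.-integrable I (EFin \o (fun x => sqmod (f x))).
Proof.
move=> [mR mJ fin]; apply/integrableP; split.
  by apply/measurable_EFinP; exact: measurable_sqmod.
under eq_integral do rewrite /= ger0_norm ?sqmod_ge0 //.
exact: fin.
Qed.

Lemma in_L2_dominated f (h : R -> R) :
  measurable_fun I (fun x => complex.Re (f x)) ->
  measurable_fun I (fun x => complex.Im (f x)) ->
  mu.-integrable I (EFin \o h) ->
  (forall x, a < x < b -> sqmod (f x) <= h x) -> in_L2 a b f.
Proof.
move=> mR mJ ih fh; split=> //.
have /integrableP[_] : mu.-integrable I (EFin \o (fun x => sqmod (f x))).
  apply: (@le_integrable _ _ _ mu _ mI _ (EFin \o h)) => //.
    by apply/measurable_EFinP; exact: measurable_sqmod.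
  move=> x; rewrite /= in_itv /= => xab.
  by rewrite lee_fin ger0_norm ?sqmod_ge0 // (le_trans (fh x xab)) // ler_norm.
by under eq_integral do rewrite /= ger0_norm ?sqmod_ge0 //.
Qed.

Lemma in_L2_integrable_Re f : in_L2 a b f ->
  mu.-integrable I (EFin \o (fun x => complex.Re (f x))).
Proof.
move=> fL; have [mR _ _] := fL.
apply: (@le_integrable _ _ _ mu _ mI _ (EFin \o (fun x => 1 + sqmod (f x)))).
- exact/measurable_EFinP.
- move=> x _; rewrite /= lee_fin (le_trans (normr_Re_le _)) //.
  by rewrite ler_norm.
- have := integrableD mI (integrable_cst_oo 1) (in_L2_integrable fL).
  exact: eq_integrable.
Qed.

Lemma in_L2_integrable_Im f : in_L2 a b f ->
  mu.-integrable I (EFin \o (fun x => complex.Im (f x))).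
Proof.
move=> fL; have [_ mJ _] := fL.
apply: (@le_integrable _ _ _ mu _ mI _ (EFin \o (fun x => 1 + sqmod (f x)))).
- exact/measurable_EFinP.
- move=> x _; rewrite /= lee_fin (le_trans (normr_Im_le _)) //.
  by rewrite ler_norm.
- have := integrableD mI (integrable_cst_oo 1) (in_L2_integrable fL).
  exact: eq_integrable.
Qed.

Lemma in_L2D f g : in_L2 a b f -> in_L2 a b g -> in_L2 a b (f + g).
Proof.
move=> fL gL; have [fR fJ _] := fL; have [gR gJ _] := gL.
apply: (@in_L2_dominated _ (fun x => 2 * sqmod (f x) + 2 * sqmod (g x))).
- have := measurable_funD fR gR; apply: eq_measurable_fun => x _.
  by rewrite /= ReD.
- have := measurable_funD fJ gJ; apply: eq_measurable_fun => x _.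
  by rewrite /= ImD.
- have := integrableD mI (integrableZl mI 2 (in_L2_integrable fL))
    (integrableZl mI 2 (in_L2_integrable gL)).
  exact: eq_integrable.
- by move=> x _; exact: sqmodD_le2.
Qed.

Lemma in_L2Z (c : R[i]) f : in_L2 a b f -> in_L2 a b (c *: f).
Proof.
move=> fL; have [fR fJ _] := fL.
apply: (@in_L2_dominated _ (fun x => sqmod c * sqmod (f x))).
- have := measurable_funB (measurable_funM (measurable_cst (complex.Re c)) fR)
    (measurable_funM (measurable_cst (complex.Im c)) fJ).
  by apply: eq_measurable_fun => x _; rewrite /= -ReM.
- have := measurable_funD (measurable_funM (measurable_cst (complex.Re c)) fJ)
    (measurable_funM (measurable_cst (complex.Im c)) fR).
  by apply: eq_measurable_fun => x _; rewrite /= -ImM.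
- have := integrableZl mI (sqmod c) (in_L2_integrable fL).
  exact: eq_integrable.
- by move=> x _; rewrite -sqmodM.
Qed.

Lemma in_L2_0 : in_L2 a b (0 : cfun R).
Proof.
apply: (@in_L2_dominated _ (cst 0)); [exact: measurable_cst..| |].
  exact: integrable_cst_oo.
by move=> x _; rewrite sqmod0.
Qed.

Lemma ae_eq_Rintegral (f g : R -> R) : measurable_fun I f -> measurable_fun I g ->
  {ae mu, forall x, a < x < b -> f x = g x} ->
  \int[mu]_(x in I) f x = \int[mu]_(x in I) g x.
Proof.
move=> mf mg fg; congr fine; apply: ae_eq_integral => //.
- exact/measurable_EFinP.
- exact/measurable_EFinP.
- apply: aeS fg => x fg; rewrite /= in_itv /= => xab.
  by rewrite fg.
Qed.

Lemma integrable_mul_continuous (f psi : R -> R) :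
  mu.-integrable I (EFin \o f) -> continuous psi ->
  mu.-integrable I (EFin \o (fun x => f x * psi x)).
Proof.
move=> fi cpsi.
have [K Kpsi] : exists K : R, forall x, a < x < b -> `|psi x| <= K.
  have [ab|ba] := leP a b; last first.
    by exists 0 => x /andP[ax xb]; move: (lt_trans (lt_trans ax xb) ba); rewrite ltxx.
  have cn : {within `[a, b], continuous (fun x => `|psi x|)}.
    apply: continuous_subspaceT => x.
    apply: (@continuous_comp _ _ _ psi (fun y : R => `|y|)); first exact: cpsi.
    exact: norm_continuous.
  have [c _ cmax] := EVT_max ab cn.
  exists `|psi c| => x /andP[ax xb]; apply: cmax.
  by rewrite in_itv /= !ltW.
have mf : measurable_fun I f by apply/measurable_EFinP; exact: measurable_int fi.
have mpsi : measurable_fun I psi.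
  apply: (@measurable_funS _ _ _ _ setT) => //.
  exact: continuous_measurable_fun.
apply: (@le_integrable _ _ _ mu _ mI _ (EFin \o (fun x => K * `|f x|))).
- by apply/measurable_EFinP; exact: (measurable_funM mf mpsi).
- move=> x; rewrite /= in_itv /= => xab; rewrite lee_fin normrM mulrC normrM.
  by rewrite normr_id ler_wpM2r // (le_trans (Kpsi x xab)) // ler_norm.
- have := integrableZl mI K (integrable_abse fi).
  exact: eq_integrable.
Qed.

End L2.

(** * Weak derivatives and traces *)

Section weak_derivative.
Context {R : realType}.
Notation mu := (@lebesgue_measure R).
Variables a b : R.
Implicit Types (f g : cfun R) (phi : R -> R).
Local Notation I := (`]a, b[%classic : set (measurableTypeR R)).

Let mI : measurable I. Proof. exact: measurable_itv. Qed.

Lemma C1c_continuous phi : C1c a b phi -> continuous phi.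
Proof.
by move=> [dphi _ _] x; apply/differentiable_continuous/derivable1_diffP.
Qed.

Lemma in_L2_test_integrable f psi : in_L2 a b f -> continuous psi ->
  mu.-integrable I (EFin \o (fun x => complex.Re (f x) * psi x)) /\
  mu.-integrable I (EFin \o (fun x => complex.Im (f x) * psi x)).
Proof.
move=> fL cpsi; split; apply: integrable_mul_continuous => //.
  exact: in_L2_integrable_Re.
exact: in_L2_integrable_Im.
Qed.

Lemma in_L2_testZD (c : R[i]) f g psi : in_L2 a b f -> in_L2 a b g ->
    continuous psi ->
  \int[mu]_(x in I) (complex.Re ((c *: f + g) x) * psi x) =
    complex.Re c * \int[mu]_(x in I) (complex.Re (f x) * psi x)
    - complex.Im c * \int[mu]_(x in I) (complex.Im (f x) * psi x)
    + \int[mu]_(x in I) (complex.Re (g x) * psi x) /\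
  \int[mu]_(x in I) (complex.Im ((c *: f + g) x) * psi x) =
    complex.Re c * \int[mu]_(x in I) (complex.Im (f x) * psi x)
    + complex.Im c * \int[mu]_(x in I) (complex.Re (f x) * psi x)
    + \int[mu]_(x in I) (complex.Im (g x) * psi x).
Proof.
move=> fL gL cpsi.
have [fR fJ] := in_L2_test_integrable fL cpsi.
have [gR gJ] := in_L2_test_integrable gL cpsi.
have iZ k (h : R -> R) : mu.-integrable I (EFin \o h) ->
    mu.-integrable I (EFin \o (fun x => k * h x)).
  by move=> hi; have := integrableZl mI k hi; exact: eq_integrable.
have iB (h1 h2 : R -> R) : mu.-integrable I (EFin \o h1) ->
    mu.-integrable I (EFin \o h2) ->
    mu.-integrable I (EFin \o (fun x => h1 x - h2 x)).
  by move=> h1i h2i; have := integrableB mI h1i h2i; exact: eq_integrable.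
have iD (h1 h2 : R -> R) : mu.-integrable I (EFin \o h1) ->
    mu.-integrable I (EFin \o h2) ->
    mu.-integrable I (EFin \o (fun x => h1 x + h2 x)).
  by move=> h1i h2i; have := integrableD mI h1i h2i; exact: eq_integrable.
split.
- rewrite -!RintegralZl // -RintegralB //; [|exact: iZ..].
  rewrite -RintegralD //; last by apply: iB; exact: iZ.
  by apply: eq_Rintegral => x _; rewrite ReD ReM; ring.
- rewrite -!RintegralZl // -RintegralD //; [|exact: iZ..].
  rewrite -RintegralD //; last by apply: iD; exact: iZ.
  by apply: eq_Rintegral => x _; rewrite ImD ImM; ring.
Qed.

Lemma is_weak_deriveZD (c : R[i]) f f' g g' :
    in_L2 a b f -> in_L2 a b f' -> in_L2 a b g -> in_L2 a b g' ->
  is_weak_derive a b f f' -> is_weak_derive a b g g' ->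
  is_weak_derive a b (c *: f + g) (c *: f' + g').
Proof.
move=> fL f'L gL g'L ff' gg' phi Cphi.
have cphi := C1c_continuous Cphi; have [_ cdphi _] := Cphi.
have [-> ->] := in_L2_testZD c fL gL cdphi.
have [-> ->] := in_L2_testZD c f'L g'L cphi.
have [-> ->] := ff' _ Cphi; have [-> ->] := gg' _ Cphi.
by split; ring.
Qed.

Lemma is_weak_derive0 : is_weak_derive a b 0 0.
Proof.
have H0 (psi : R -> R) : \int[mu]_(x in I) (0 * psi x) = 0.
  by under eq_Rintegral do rewrite mul0r; rewrite Rintegral_cst // mul0r.
by move=> phi _; split; rewrite [LHS]H0 [X in - X]H0 oppr0.
Qed.

Lemma is_weak_derive_unique f g1 g2 : in_L2 a b g1 -> in_L2 a b g2 ->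
  is_weak_derive a b f g1 -> is_weak_derive a b f g2 ->
  {ae mu, forall x, a < x < b -> g1 x = g2 x}.
Proof.
move=> g1L g2L fg1 fg2.
have NL := in_L2Z (-1) g2L.
have dL : in_L2 a b ((-1) *: g2 + g1) by exact: in_L2D.
have d0 phi : C1c a b phi ->
    \int[mu]_(x in I) (complex.Re (((-1) *: g2 + g1) x) * phi x) = 0 /\
    \int[mu]_(x in I) (complex.Im (((-1) *: g2 + g1) x) * phi x) = 0.
  move=> Cphi; have cphi := C1c_continuous Cphi.
  have [-> ->] := in_L2_testZD (-1) g2L g1L cphi.
  have [e1 e2] := fg1 _ Cphi; have [e3 e4] := fg2 _ Cphi.
  by split=> /=; lra.
have R0 := ae_eq0_of_C1c (in_L2_integrable_Re dL) (fun phi Cp => (d0 phi Cp).1).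
have J0 := ae_eq0_of_C1c (in_L2_integrable_Im dL) (fun phi Cp => (d0 phi Cp).2).
apply: aeS2 R0 J0 => x Rx Jx xab.
have /= := Rx xab; rewrite ReD /= => eR.
have /= := Jx xab; rewrite ImD /= => eJ.
have e : -1 *: (g2 x : R[i]^o) + g1 x = 0 by apply: eq_complexP; [rewrite ReD|rewrite ImD].
by move/eqP: e; rewrite scaleN1r addrC subr_eq0 => /eqP.
Qed.

Lemma is_weak_derive_ae f1 f2 g1 g2 :
    in_L2 a b f1 -> in_L2 a b f2 -> in_L2 a b g1 -> in_L2 a b g2 ->
    {ae mu, forall x, a < x < b -> f1 x = f2 x} ->
    {ae mu, forall x, a < x < b -> g1 x = g2 x} ->
  is_weak_derive a b f1 g1 -> is_weak_derive a b f2 g2.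
Proof.
move=> f1L f2L g1L g2L f12 g12 fg phi Cphi.
have H f g psi : in_L2 a b f -> in_L2 a b g -> continuous psi ->
   {ae mu, forall x, a < x < b -> f x = g x} ->
   \int[mu]_(x in I) (complex.Re (f x) * psi x) =
   \int[mu]_(x in I) (complex.Re (g x) * psi x) /\
   \int[mu]_(x in I) (complex.Im (f x) * psi x) =
   \int[mu]_(x in I) (complex.Im (g x) * psi x).
  move=> fL gL cpsi fgae.
  have [fR fJ] := in_L2_test_integrable fL cpsi.
  have [gR gJ] := in_L2_test_integrable gL cpsi.
  split; apply: ae_eq_Rintegral; try (apply/measurable_EFinP;
    first [exact: measurable_int fR|exact: measurable_int gR|
           exact: measurable_int fJ|exact: measurable_int gJ]);
    by apply: aeS fgae => x e /e ->.
have cphi := C1c_continuous Cphi; have [_ cdphi _] := Cphi.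
have [<- <-] := H _ _ _ f1L f2L cdphi f12.
by have [<- <-] := H _ _ _ g1L g2L cphi g12; exact: fg.
Qed.

(** The bridge from the representative chosen by [xget] to an explicit candidate [g]; equality can
    only be claimed almost everywhere. *)
Lemma weak_deriveP f g : in_L2 a b g -> is_weak_derive a b f g ->
  [/\ in_L2 a b (weak_derive a b f),
      is_weak_derive a b f (weak_derive a b f) &
      {ae mu, forall x, a < x < b -> weak_derive a b f x = g x}].
Proof.
move=> gL fg.
have [wL fw] : in_L2 a b (weak_derive a b f) /\
    is_weak_derive a b f (weak_derive a b f).
  by rewrite /weak_derive; apply: (@xgetPex _ _ (fun g => in_L2 a b g /\ _)); exists g.
by split=> //; exact: is_weak_derive_unique fw fg.
Qed.

End weak_derivative.

(* A continuous piecewise C1 function is a sum of truncations of C1 functions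
   which vanish at the point of truncation. *)
Definition trunc (R : realType) (V : zmodType) (c : R) (f : R -> V) (x : R) : V :=
  if x < c then f x else 0.

Section trunc_weak_derivative.
Context {R : realType}.
Notation mu := (@lebesgue_measure R).
Variables a b c : R.
Hypotheses (ac : a < c) (cb : c <= b).
Local Notation I := (`]a, b[%classic : set (measurableTypeR R)).

(** Passes to the closed interval [[a, c]], on which the untruncated functions are continuous and
    can be integrated by parts. *)
Lemma Rintegral_trunc (f psi : R -> R) : continuous f -> continuous psi ->
  \int[mu]_(x in I) (trunc c f x * psi x) =
  \int[mu]_(x in `[a, c]) (f x * psi x).
Proof.
move=> cf cpsi.
have iac : mu.-integrable `[a, c] (EFin \o (fun x => f x * psi x)).
  apply: continuous_compact_integrable; first exact: segment_compact.
  apply: continuous_subspaceT => x.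
  by apply: cvgM; [exact: cf | exact: cpsi].
rewrite -Rintegral_itv_obnd_cbnd; last first.
  apply: integrableS iac => //; try exact: measurable_itv.
  by apply: subset_itvr; rewrite bnd_simp.
rewrite -Rintegral_itv_bndo_bndc; last first.
  apply: integrableS iac => //; try exact: measurable_itv.
  by move=> x; rewrite /= !in_itv /= => /andP[/ltW -> /ltW ->].
have -> : `]a, c[%classic = I `&` `]-oo, c[%classic :> set R.
  apply/seteqP; split=> x /=; rewrite !in_itv /=.
    by move=> /andP[-> xc]; rewrite xc (lt_le_trans xc cb).
  by move=> [/andP[-> _] ->].
rewrite Rintegral_mkcondr; apply: eq_Rintegral => x _.
rewrite patchE /trunc; case: ifPn => xc.
  by rewrite mem_set //= in_itv.
by rewrite memNset ?mul0r //= in_itv /=; exact/negP.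
Qed.

(** The boundary term at [c] vanishes with [h], the one at [a] with the test function; so truncating
    at a zero of [h] creates no Dirac mass. *)
Lemma Rintegral_trunc_by_parts (h h' phi : R -> R) : C1_derive h h' ->
  h c = 0 -> C1c a b phi ->
  \int[mu]_(x in I) (trunc c h x * derive1 phi x) =
  - \int[mu]_(x in I) (trunc c h' x * phi x).
Proof.
move=> Ch hc0 Cphi.
have ch := C1_derive_continuous Ch; have [dh ch'] := Ch.
have cphi := C1c_continuous Cphi; have [dphi cdphi [d [e [ad eb phi0]]]] := Cphi.
rewrite !Rintegral_trunc //.
have LR (f : R -> R) : (forall x, derivable f x 1) -> continuous f ->
    derivable_oo_LRcontinuous f a c.
  move=> df cf; split=> [x _||]; first exact: df.
    by apply: cvg_at_right_filter; exact: cf.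
  by apply: cvg_at_left_filter; exact: cf.
rewrite (@Rintegration_by_parts _ h phi h' (derive1 phi)).
- by rewrite hc0 mul0r (phi0 a) ?mulr0 ?subrr ?sub0r // in_itv /= leNgt ad.
- exact: ac.
- exact: continuous_subspaceT.
- by apply: LR ch => x; case: (dh x).
- by move=> x _; rewrite (C1_derive1 Ch).
- exact: continuous_subspaceT.
- exact: LR dphi cphi.
- by [].
Qed.

Lemma measurable_trunc (f : R -> R) : continuous f ->
  measurable_fun I (trunc c f).
Proof.
move=> cf.
have -> : trunc c f = (fun x => f x * \1_(`]-oo, c[%classic : set R) x).
  apply/funext => x; rewrite /trunc indicE; case: ifPn => xc.
    by rewrite mem_set ?mulr1 //= in_itv.
  by rewrite memNset ?mulr0 //= in_itv /=; exact/negP.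
apply: measurable_funM; last exact: measurable_indic.
apply: (@measurable_funS _ _ _ _ setT) => //.
exact: continuous_measurable_fun.
Qed.

End trunc_weak_derivative.

(** Componentwise, to match [is_weak_derive], which tests real and imaginary parts separately. *)
Definition C1_cderive (R : realType) (f f' : R -> R[i]) : Prop :=
  C1_derive (fun x => complex.Re (f x)) (fun x => complex.Re (f' x)) /\
  C1_derive (fun x => complex.Im (f x)) (fun x => complex.Im (f' x)).

Section C1_cderive_theory.
Context {R : realType}.
Implicit Types (f g : R -> R[i]) (r : R -> R).

Lemma C1_cderive_eq f f' g' : (forall x, f' x = g' x) ->
  C1_cderive f f' -> C1_cderive f g'.
Proof. by move=> /funext ->. Qed.

Lemma C1_cderive_cst (c : R[i]) : C1_cderive (fun=> c) (fun=> 0).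
Proof. by split; exact: C1_derive_cst. Qed.

Lemma C1_cderive_real r r' : C1_derive r r' ->
  C1_cderive (fun x => (r x)%:C%C) (fun x => (r' x)%:C%C).
Proof. by move=> dr; split=> //=; exact: C1_derive_cst. Qed.

Lemma C1_cderiveD f f' g g' : C1_cderive f f' -> C1_cderive g g' ->
  C1_cderive (fun x => f x + g x) (fun x => f' x + g' x).
Proof.
move=> [fR fJ] [gR gJ]; split.
  by have := C1_deriveD fR gR; congr C1_derive; apply/funext => x; rewrite ReD.
by have := C1_deriveD fJ gJ; congr C1_derive; apply/funext => x; rewrite ImD.
Qed.

Lemma C1_cderiveB f f' g g' : C1_cderive f f' -> C1_cderive g g' ->
  C1_cderive (fun x => f x - g x) (fun x => f' x - g' x).
Proof.
move=> [fR fJ] [gR gJ]; split.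
  by have := C1_deriveB fR gR; congr C1_derive; apply/funext => x; rewrite ReB.
by have := C1_deriveB fJ gJ; congr C1_derive; apply/funext => x; rewrite ImB.
Qed.

Lemma C1_cderiveM f f' g g' : C1_cderive f f' -> C1_cderive g g' ->
  C1_cderive (fun x => f x * g x) (fun x => f' x * g x + f x * g' x).
Proof.
move=> [fR fJ] [gR gJ]; split.
  have := C1_deriveB (C1_deriveM fR gR) (C1_deriveM fJ gJ).
  congr C1_derive; apply/funext => x; first by rewrite ReM.
  by rewrite ReD !ReM; ring.
have := C1_deriveD (C1_deriveM fR gJ) (C1_deriveM fJ gR).
congr C1_derive; apply/funext => x; first by rewrite ImM.
by rewrite ImD !ImM; ring.
Qed.

Lemma C1_cderiveZ (c : R[i]) f f' : C1_cderive f f' ->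
  C1_cderive (fun x => c * f x) (fun x => c * f' x).
Proof.
move=> df; apply: C1_cderive_eq (C1_cderiveM (C1_cderive_cst c) df) => x.
by rewrite mul0r add0r.
Qed.

End C1_cderive_theory.

Section trunc_H1.
Context {R : realType}.
Notation mu := (@lebesgue_measure R).
Variables a b c : R.
Local Notation I := (`]a, b[%classic : set (measurableTypeR R)).

Lemma Re_trunc (f : R -> R[i]) x :
  complex.Re (trunc c f x) = trunc c (fun x => complex.Re (f x)) x.
Proof. by rewrite /trunc; case: ifP. Qed.

Lemma Im_trunc (f : R -> R[i]) x :
  complex.Im (trunc c f x) = trunc c (fun x => complex.Im (f x)) x.
Proof. by rewrite /trunc; case: ifP. Qed.

Lemma in_L2_trunc (f : R -> R[i]) :
  continuous (fun x => complex.Re (f x)) ->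
  continuous (fun x => complex.Im (f x)) -> in_L2 a b (trunc c f).
Proof.
move=> cR cJ.
apply: (@in_L2_dominated _ _ _ _ (fun x => 1 * sqmod (f x))).
- have -> : (fun x => complex.Re (trunc c f x)) = trunc c (fun x => complex.Re (f x)).
    by apply/funext => x; rewrite Re_trunc.
  exact: measurable_trunc.
- have -> : (fun x => complex.Im (trunc c f x)) = trunc c (fun x => complex.Im (f x)).
    by apply/funext => x; rewrite Im_trunc.
  exact: measurable_trunc.
- apply: integrable_mul_continuous; first exact: integrable_cst_oo.
  by move=> x; apply: cvgD; apply: cvgM; first [exact: cR | exact: cJ].
- move=> x _; rewrite mul1r /trunc; case: ifP => // _.
  by rewrite sqmod0 sqmod_ge0.
Qed.

Lemma trunc_weak_derive (f f' : R -> R[i]) : a < c -> c <= b ->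
  C1_cderive f f' -> f c = 0 ->
  [/\ in_L2 a b (trunc c f), in_L2 a b (trunc c f') &
      is_weak_derive a b (trunc c f) (trunc c f')].
Proof.
move=> ac cb [dR dJ] fc0; split.
- by apply: in_L2_trunc; [exact: C1_derive_continuous dR | exact: C1_derive_continuous dJ].
- by apply: in_L2_trunc; [case: dR | case: dJ].
- move=> phi Cphi; split.
  + under eq_Rintegral do rewrite Re_trunc.
    under [in RHS]eq_Rintegral do rewrite Re_trunc.
    by apply: Rintegral_trunc_by_parts => //; rewrite fc0.
  + under eq_Rintegral do rewrite Im_trunc.
    under [in RHS]eq_Rintegral do rewrite Im_trunc.
    by apply: Rintegral_trunc_by_parts => //; rewrite fc0.
Qed.

End trunc_H1.

Section trace.
Context {R : realType}.
Notation mu := (@lebesgue_measure R).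
Variables (a b x0 : R).
Implicit Types f g : cfun R.

Lemma has_traceZD (k c c' : R[i]) f g : has_trace a b f x0 c ->
  has_trace a b g x0 c' -> has_trace a b (k *: f + g) x0 (k * c + c').
Proof.
move=> fc gc' e e0.
have m0 := sqmod_ge0 k; set m := sqmod k in m0.
(* The division by [1 + m] compensates the factor [m], also when [k = 0]; the halves are chosen
   because 2 (e/2)^2 + 2 (e/2)^2 = e^2. *)
have e1 : 0 < e / 2 / (1 + m) by rewrite !divr_gt0 // ltr_wpDr.
have e2 : 0 < e / 2 by rewrite divr_gt0.
have [d1 d10 H1] := fc _ e1; have [d2 d20 H2] := gc' _ e2.
exists (Num.min d1 d2); first by rewrite lt_min d10.
apply: aeS2 H1 H2 => y H1 H2 yab; rewrite lt_min => /andP[yd1 yd2].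
have -> : (k *: f + g) y - (k * c + c') = k * (f y - c) + (g y - c').
  by rewrite mulrBr opprD addrACA.
apply: le_lt_trans (sqmodD_le2 _ _) _; rewrite sqmodM -/m.
have {H1} := H1 yab yd1; have {H2} := H2 yab yd2.
set X := sqmod (f y - c); set Y := sqmod (g y - c') => HY HX.
have XX : m * X <= (e / 2) ^+ 2.
  apply: (@le_trans _ _ (m * (e / 2 / (1 + m)) ^+ 2)).
    by rewrite ler_wpM2l // ltW.
  rewrite expr_div_n mulrCA ler_piMr ?sqr_ge0 //.
  by rewrite ler_pdivrMr ?mul1r ?exprn_gt0 ?ltr_wpDr //; nra.
by move: XX HY; rewrite !expr2; lra.
Qed.

Lemma has_trace0 : has_trace a b (0 : cfun R) x0 0.
Proof.
move=> e e0; exists 1 => //; apply: aeW => y _ _.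
by rewrite subr0 sqmod0 exprn_gt0.
Qed.

Lemma has_trace_locally0 f d : 0 < d ->
  {ae mu, forall y, a < y < b -> `|y - x0| < d -> f y = 0} ->
  has_trace a b f x0 0.
Proof.
move=> d0 f0 e e0; exists d => //; apply: aeS f0 => y H yab yd.
by rewrite H // subr0 sqmod0 exprn_gt0.
Qed.

Lemma has_trace_continuous f (h : R -> R[i]) d : 0 < d ->
  (forall y, a < y < b -> `|y - x0| < d -> f y = h y) ->
  continuous (fun x => complex.Re (h x)) ->
  continuous (fun x => complex.Im (h x)) ->
  has_trace a b f x0 (h x0).
Proof.
move=> d0 fh cR cJ e e0.
have e2 : 0 < e / 2 by rewrite divr_gt0.
have : \forall y \near x0, `|complex.Re (h x0) - complex.Re (h y)| < e / 2 /\
   `|complex.Im (h x0) - complex.Im (h y)| < e / 2.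
  near=> y; split; near: y.
    by move: (cR x0) => /cvgrPdist_lt; apply.
  by move: (cJ x0) => /cvgrPdist_lt; apply.
move=> /nbhs_ballP[d' /= d'0 H].
exists (Num.min d d'); first by rewrite lt_min d0.
apply: aeW => y yab; rewrite lt_min => /andP[yd yd'].
rewrite fh // /sqmod ReB ImB.
have [] := H y; first by rewrite /ball /= distrC.
rewrite (distrC (complex.Re (h x0))) (distrC (complex.Im (h x0))).
set X := _ - _; set Y := _ - _ => HX HY.
rewrite -(real_normK (num_real X)) -(real_normK (num_real Y)).
have := normr_ge0 X; have := normr_ge0 Y; rewrite !expr2; nra.
Unshelve. all: by end_near. Qed.

End trace.

(** * The energy norm *)

(** For positive x and y the minimum over s of (1 + s) x + (1 + 1/s) y is (sqrt x + sqrt y)^2, so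
    the whole family of Young bounds is as strong as Cauchy-Schwarz. Unlike the latter it adds up
    over the four terms of the energy at a common [s]. *)
Lemma sqrt_subadditive (R : realType) (x y z : R) : 0 <= x -> 0 <= y ->
  (forall s : R, 0 < s -> z <= (1 + s) * x + (1 + s^-1) * y) ->
  Num.sqrt z <= Num.sqrt x + Num.sqrt y.
Proof.
move=> x0 y0 H; pose u : R := Num.sqrt x; pose v : R := Num.sqrt y.
rewrite -/u -/v.
have u0 : 0 <= u := sqrtr_ge0 x.
have v0 : 0 <= v := sqrtr_ge0 y.
have xu : x = u ^+ 2 by rewrite sqr_sqrtr.
have yv : y = v ^+ 2 by rewrite sqr_sqrtr.
suff zuv : z <= (u + v) ^+ 2.
  by apply: (le_trans (ler_wsqrtr zuv)); rewrite sqrtr_sqr ger0_norm ?addr_ge0.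
apply/ler_addgt0Pr => e' e'0.
(* Shifting both [u] and [v] by [e] costs [e * (u + v)], which this choice keeps below [e']. *)
pose e := e' / (u + v + 1).
have uv1 : 0 < u + v + 1 by rewrite ltr_wpDl ?addr_ge0.
have e0 : 0 < e by rewrite divr_gt0.
have ue : 0 < u + e by rewrite ltr_wpDl.
have ve : 0 < v + e by rewrite ltr_wpDl.
(* the optimal weight is [v / u]; it is shifted to stay positive *)
have := H _ (divr_gt0 ve ue); rewrite invf_div xu yv => Hz.
apply: (le_trans Hz).
have E1 : (v + e) / (u + e) * u ^+ 2 <= (v + e) * u.
  rewrite -mulrA ler_wpM2l ?(ltW ve) // mulrC ler_pdivrMr // expr2.
  by rewrite ler_wpM2l // lerDl ltW.
have E2 : (u + e) / (v + e) * v ^+ 2 <= (u + e) * v.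
  rewrite -mulrA ler_wpM2l ?(ltW ue) // mulrC ler_pdivrMr // expr2.
  by rewrite ler_wpM2l // lerDl ltW.
have E3 : e * (u + v) <= e'.
  by rewrite /e mulrAC ler_pdivrMr // ler_wpM2l ?lerDl ?(ltW e'0).
by rewrite !mulrDl !mul1r; lra.
Qed.

Section L2_norm.
Context {R : realType}.
Notation mu := (@lebesgue_measure R).
Variables a b : R.
Implicit Types f g : cfun R.
Local Notation I := (`]a, b[%classic : set (measurableTypeR R)).

Let mI : measurable I. Proof. exact: measurable_itv. Qed.

Definition L2sq f : R := \int[mu]_(x in I) sqmod (f x).

Lemma L2sq_ge0 f : 0 <= L2sq f.
Proof. by apply: Rintegral_ge0 => x _; exact: sqmod_ge0. Qed.

Lemma eq_L2sq f g : in_L2 a b f -> in_L2 a b g ->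
  {ae mu, forall x, a < x < b -> f x = g x} -> L2sq f = L2sq g.
Proof.
move=> fL gL fg; apply: ae_eq_Rintegral.
- by apply/measurable_EFinP; exact: measurable_int (in_L2_integrable fL).
- by apply/measurable_EFinP; exact: measurable_int (in_L2_integrable gL).
- by apply: aeS fg => x e /e ->.
Qed.

Lemma L2sqD_le s f g : 0 < s -> in_L2 a b f -> in_L2 a b g ->
  L2sq (f + g) <= (1 + s) * L2sq f + (1 + s^-1) * L2sq g.
Proof.
move=> s0 fL gL.
have fi := in_L2_integrable fL; have gi := in_L2_integrable gL.
have iZ k (h : R -> R) : mu.-integrable I (EFin \o h) ->
    mu.-integrable I (EFin \o (fun x => k * h x)).
  by move=> hi; have := integrableZl mI k hi; exact: eq_integrable.
rewrite /L2sq -!RintegralZl // -RintegralD //; [|exact: iZ..].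
apply: le_Rintegral => //.
- exact: in_L2_integrable (in_L2D fL gL).
- have := integrableD mI (iZ (1 + s) _ fi) (iZ (1 + s^-1) _ gi).
  exact: eq_integrable.
- by move=> x _; exact: sqmodD_le.
Qed.

Lemma L2sqZ (c : R[i]) f : in_L2 a b f -> L2sq (c *: f) = sqmod c * L2sq f.
Proof.
move=> fL; have fi := in_L2_integrable fL.
by rewrite /L2sq -RintegralZl //; apply: eq_Rintegral => x _; rewrite sqmodM.
Qed.

Lemma L2sq_le K f : a <= b -> in_L2 a b f ->
  (forall x, a < x < b -> sqmod (f x) <= K) -> L2sq f <= K * (b - a).
Proof.
move=> ab fL fK.
have -> : K * (b - a) = \int[mu]_(x in I) (cst K x).
  rewrite Rintegral_cst //= lebesgue_measure_itv /= lte_fin.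
  by move: ab; rewrite le_eqVlt => /predU1P[->|->//]; rewrite ltxx subrr.
apply: le_Rintegral => //.
- exact: in_L2_integrable.
- exact: integrable_cst_oo.
Qed.

Lemma in_H1_weak_derive f : in_H1 a b f ->
  in_L2 a b (weak_derive a b f) /\ is_weak_derive a b f (weak_derive a b f).
Proof. by move=> [_ [g gL fg]]; have [] := weak_deriveP gL fg. Qed.

Lemma weak_deriveZD (c : R[i]) f g : in_H1 a b f -> in_H1 a b g ->
  {ae mu, forall x, a < x < b -> weak_derive a b (c *: f + g) x =
     (c *: weak_derive a b f + weak_derive a b g) x}.
Proof.
move=> fH gH; have [dfL df] := in_H1_weak_derive fH.
have [dgL dg] := in_H1_weak_derive gH.
have dL : in_L2 a b (c *: weak_derive a b f + weak_derive a b g).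
  by apply: in_L2D => //; exact: in_L2Z.
by have [] := weak_deriveP dL (is_weak_deriveZD c fH.1 dfL gH.1 dgL df dg).
Qed.

Lemma in_H1ZD (c : R[i]) f g : in_H1 a b f -> in_H1 a b g ->
  in_H1 a b (c *: f + g).
Proof.
move=> fH gH; have [dfL df] := in_H1_weak_derive fH.
have [dgL dg] := in_H1_weak_derive gH; split.
  by apply: in_L2D; [apply: in_L2Z; case: fH | case: gH].
exists (c *: weak_derive a b f + weak_derive a b g).
  by apply: in_L2D => //; exact: in_L2Z.
by apply: is_weak_deriveZD => //; [case: fH | case: gH].
Qed.

Lemma in_H1_0 : in_H1 a b 0.
Proof.
split; first exact: in_L2_0.
by exists 0; [exact: in_L2_0 | exact: is_weak_derive0].
Qed.

Lemma L2sq_weak_deriveD_le s f g : 0 < s -> in_H1 a b f -> in_H1 a b g ->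
  L2sq (weak_derive a b (f + g)) <= (1 + s) * L2sq (weak_derive a b f)
    + (1 + s^-1) * L2sq (weak_derive a b g).
Proof.
move=> s0 fH gH; rewrite -[f in f + g]scale1r.
have [wL _] := in_H1_weak_derive (in_H1ZD 1 fH gH).
have [dfL _] := in_H1_weak_derive fH; have [dgL _] := in_H1_weak_derive gH.
rewrite (eq_L2sq wL _ (weak_deriveZD 1 fH gH)); last first.
  by apply: in_L2D => //; exact: in_L2Z.
by rewrite scale1r; exact: L2sqD_le.
Qed.

Lemma L2sq_weak_deriveZ (c : R[i]) f : in_H1 a b f ->
  L2sq (weak_derive a b (c *: f)) = sqmod c * L2sq (weak_derive a b f).
Proof.
move=> fH; rewrite -[c *: f]addr0.
have [wL _] := in_H1_weak_derive (in_H1ZD c fH in_H1_0).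
have [dfL _] := in_H1_weak_derive fH.
have [d0L _ d0] := weak_deriveP (in_L2_0 a b) (@is_weak_derive0 R a b).
rewrite -(L2sqZ c dfL); apply: (eq_L2sq wL (in_L2Z c dfL)).
apply: aeS2 (weak_deriveZD c fH in_H1_0) d0 => x e1 e2 xab.
by rewrite e1 // -[RHS]addr0; congr (_ + _); rewrite e2.
Qed.

End L2_norm.

Section energy_norm.
Context {R : realType}.
Variables l L p1 p2 : R.
Hypotheses (p1_gt0 : 0 < p1) (p2_gt0 : 0 < p2).
Implicit Types U W : state R.
Local Notation E := (in_H2 l L).
Local Notation N := (norm_H2 l L p1 p2).

Definition energy U : R :=
  p1 * L2sq 0 l (weak_derive 0 l U.1.1) + p2 * L2sq l L (weak_derive l L U.1.2)
  + L2sq 0 l U.2.1 + L2sq l L U.2.2.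

Lemma norm_H2E U : E U -> N U = Num.sqrt (energy U).
Proof.
move=> [[u1H u2H _ _ _] _].
have i1 := in_L2_integrable (in_H1_weak_derive u1H).1.
have i2 := in_L2_integrable (in_H1_weak_derive u2H).1.
by rewrite /norm_H2 /energy /L2sq !RintegralZl //; exact: measurable_itv.
Qed.

Lemma in_V2ZD (c : R[i]) (u w : cfun R * cfun R) :
  in_V2 l L u -> in_V2 l L w -> in_V2 l L (c *: u + w).
Proof.
move=> [u1 u2 [t tu1 tu2] u0 uL] [w1 w2 [t' tw1 tw2] w0 wL]; split.
- exact: in_H1ZD.
- exact: in_H1ZD.
- by exists (c * t + t'); exact: has_traceZD.
- by have := has_traceZD c u0 w0; rewrite mulr0 addr0.
- by have := has_traceZD c uL wL; rewrite mulr0 addr0.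
Qed.

Lemma in_V2_0 : in_V2 l L 0.
Proof.
split; [exact: in_H1_0|exact: in_H1_0| |exact: has_trace0|exact: has_trace0].
by exists 0; exact: has_trace0.
Qed.

Lemma in_H2ZD (c : R[i]) U W : E U -> E W -> E (c *: U + W).
Proof.
move=> [u [v1 v2]] [u' [v1' v2']]; split; first exact: in_V2ZD.
split; first exact: (in_L2D (in_L2Z c v1) v1').
exact: (in_L2D (in_L2Z c v2) v2').
Qed.

Lemma in_H2_0 : E 0.
Proof. by split; [exact: in_V2_0 | split; exact: in_L2_0]. Qed.

Lemma energy_ge0 U : 0 <= energy U.
Proof.
by rewrite !addr_ge0 ?L2sq_ge0 ?mulr_ge0 ?L2sq_ge0 ?(ltW p1_gt0) ?(ltW p2_gt0).
Qed.

Lemma norm_H2Z (c : R[i]) U : E U -> N (c *: U) = Num.sqrt (sqmod c) * N U.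
Proof.
move=> EU; have EcU : E (c *: U).
  by rewrite -[c *: U]addr0; apply: in_H2ZD => //; exact: in_H2_0.
rewrite !norm_H2E // -sqrtrM ?sqmod_ge0 //; congr Num.sqrt.
case: EU => [[u1 u2 _ _ _] [v1 v2]].
rewrite /energy (L2sq_weak_deriveZ c u1 : L2sq _ _ (weak_derive _ _ (c *: U).1.1) = _).
rewrite (L2sq_weak_deriveZ c u2 : L2sq _ _ (weak_derive _ _ (c *: U).1.2) = _).
rewrite (L2sqZ c v1 : L2sq _ _ (c *: U).2.1 = _).
rewrite (L2sqZ c v2 : L2sq _ _ (c *: U).2.2 = _).
by ring.
Qed.

Lemma norm_H2D U W : E U -> E W -> N (U + W) <= N U + N W.
Proof.
move=> EU EW; have EUW : E (U + W).
  by rewrite -[U]scale1r; exact: in_H2ZD.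
rewrite !norm_H2E //; apply: sqrt_subadditive; [exact: energy_ge0..|].
move=> s s0; rewrite /energy.
case: EU => [[u1 u2 _ _ _] [v1 v2]]; case: EW => [[u1' u2' _ _ _] [v1' v2']].
have sum4 (z1 z2 z3 z4 x1 x2 x3 x4 y1 y2 y3 y4 : R) :
    z1 <= (1 + s) * x1 + (1 + s^-1) * y1 -> z2 <= (1 + s) * x2 + (1 + s^-1) * y2 ->
    z3 <= (1 + s) * x3 + (1 + s^-1) * y3 -> z4 <= (1 + s) * x4 + (1 + s^-1) * y4 ->
    p1 * z1 + p2 * z2 + z3 + z4 <= (1 + s) * (p1 * x1 + p2 * x2 + x3 + x4)
      + (1 + s^-1) * (p1 * y1 + p2 * y2 + y3 + y4).
  move=> /(ler_wpM2l (ltW p1_gt0)) h1 /(ler_wpM2l (ltW p2_gt0)) h2 h3 h4.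
  by lra.
exact: (sum4 _ _ _ _ _ _ _ _ _ _ _ _ (L2sq_weak_deriveD_le s0 u1 u1')
  (L2sq_weak_deriveD_le s0 u2 u2') (L2sqD_le s0 v1 v1') (L2sqD_le s0 v2 v2')).
Qed.

End energy_norm.

(** * Quasimodes of an operator *)

Definition cis (R : realType) (t : R) : R[i] := (cos t +i* sin t)%C.

Section cis_theory.
Context {R : realType}.

Lemma cis0 : cis 0 = 1 :> R[i].
Proof. by rewrite /cis cos0 sin0. Qed.

Lemma cisD (s t : R) : cis (s + t) = cis s * cis t.
Proof.
by apply: eq_complexP; rewrite ?ReM ?ImM /= ?cosD ?sinD // [RHS]addrC.
Qed.

Lemma sqmod_cis (t : R) : sqmod (cis t) = 1.
Proof. by rewrite /sqmod /= cos2Dsin2. Qed.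

(** In the expansion of (T h U - cis (lambda h) U) / h around A U - i lambda U, this quantity is the
    coefficient of the error in U. *)
Lemma cis_derive (lambda e : R) : 0 < e -> \forall h \near 0^'+,
  sqmod ((h^-1)%:C%C * (1 - cis (lambda * h)) + (0 +i* lambda)%C) <= e ^+ 2.
Proof.
move=> e0; have e2 : 0 < e / 2 by rewrite divr_gt0.
have dlin : C1_derive (fun x : R => lambda * x) (fun=> lambda).
  apply: C1_derive_eq (C1_deriveM (C1_derive_cst lambda) C1_derive_id) => x.
  by rewrite mul0r add0r mulr1.
have dq (f f' : R -> R) : C1_derive f f' ->
    h^-1 * (f h - f 0) @[h --> 0^'+] --> f' 0.
  move=> [/(_ 0) [fd <-] _]; have := cvg_at_right_within.
  have : h^-1 *: (f (h *: (1 : R) + 0) - f 0) @[h --> (0 : R)^'] --> 'D_1 f 0 by exact: fd.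
  move=> H _; have {}H := cvg_dnbhs_at_right H.
  apply: cvg_trans H; apply: near_eq_cvg; near=> h.
  by rewrite addr0 /GRing.scale /= mulr1.
have dc := dq _ _ (C1_derive_comp C1_derive_cos dlin).
have ds := dq _ _ (C1_derive_comp C1_derive_sin dlin).
rewrite mulr0 sin0 oppr0 mul0r in dc; rewrite mulr0 cos0 mul1r in ds.
rewrite cos0 in dc; rewrite sin0 in ds.
near=> h.
have Hc : `|h^-1 * (cos (lambda * h) - 1)| < e / 2.
  rewrite -[X in `|X|]subr0 distrC; near: h.
  by move: dc => /cvgrPdist_lt; apply.
have Hs : `|lambda - h^-1 * (sin (lambda * h) - 0)| < e / 2.
  near: h; by move: ds => /cvgrPdist_lt; apply.
rewrite /sqmod ReD ImD ReM ImM ReB ImB /= !mul0r !subr0 addr0 addr0.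
rewrite -(real_normK (num_real (_ * _))) -(real_normK (num_real (_ + _))).
rewrite -[h^-1 * (1 - _)]opprK -mulrN opprB normrN.
rewrite [_ + lambda](_ : _ = lambda - h^-1 * (sin (lambda * h) - 0)); last by ring.
move: (normr_ge0 (h^-1 * (cos (lambda * h) - 1))) Hc.
move: (normr_ge0 (lambda - h^-1 * (sin (lambda * h) - 0))) Hs.
move: `|_| `|_| => X Y X0 HX Y0 HY; nra.
Unshelve. all: by end_near. Qed.

End cis_theory.

Lemma powR_unbounded (R : realType) (r C : R) : 0 < r ->
  exists x0 : R, forall x, x0 <= x -> C < x `^ r.
Proof.
move=> r0; exists ((`|C| + 1) `^ r^-1) => x xx0.
have C1 : 0 <= `|C| + 1 by rewrite addr_ge0.
apply: (@lt_le_trans _ _ (`|C| + 1)).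
  by apply: le_lt_trans (ler_norm C) _; rewrite ltrDl.
have -> : `|C| + 1 = ((`|C| + 1) `^ r^-1) `^ r.
  by rewrite -powRrM mulVf ?gt_eqF // powRr1.
apply: ge0_ler_powR; rewrite ?nnegrE ?powR_ge0 ?(ltW r0) //.
exact: le_trans (powR_ge0 _ _) xx0.
Qed.

Section seminorm.
Context {R : realType} {X : lmodType R[i]}.
Variables (E : set X) (N : X -> R).
Hypothesis E_lin : forall c U W, E U -> E W -> E (c *: U + W).
Hypothesis NZ : forall c U, E U -> N (c *: U) = Num.sqrt (sqmod c) * N U.
Hypothesis ND : forall U W, E U -> E W -> N (U + W) <= N U + N W.

Let EZ c U : E U -> E (c *: U).
Proof.
move=> EU; have E0 : E (0 : X) by rewrite -(addNr U) -scaleN1r; exact: E_lin.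
by rewrite -[c *: U]addr0; exact: E_lin.
Qed.

Let ED U W : E U -> E W -> E (U + W).
Proof. by rewrite -{2}[U]scale1r; exact: E_lin. Qed.

Let EN U : E U -> E (- U).
Proof. by rewrite -scaleN1r; exact: EZ. Qed.

Let EB U W : E U -> E W -> E (U - W).
Proof. by move=> EU EW; apply: ED => //; exact: EN. Qed.

Let NN U : E U -> N (- U) = N U.
Proof.
by move=> EU; rewrite -scaleN1r NZ // sqmodN /sqmod /= expr0n expr1n addr0 sqrtr1 mul1r.
Qed.

Let N0 U : E U -> N (0 : X) = 0.
Proof. by move=> EU; rewrite -(scale0r U) NZ // sqmod0 sqrtr0 mul0r. Qed.

Let N_ge0 U : E U -> 0 <= N U.
Proof.
by move=> EU; have := ND EU (EN EU); rewrite NN // subrr (N0 EU); lra.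
Qed.

Variables (D : set X) (A : X -> X).

(* normalized by its residual rather than by its norm *)
Definition quasimode (K lambda : R) (U : X) : Prop :=
  [/\ D U, E U, E (A U), N ((0 +i* lambda)%C *: U - A U) <= 1 &
      K * Num.sqrt lambda <= N U].

Section resolvent.
Variable K : R.
Hypothesis K_gt0 : 0 < K.
Hypothesis quasimodes : forall Lambda : R, exists lambda U,
  Lambda <= lambda /\ quasimode K lambda U.

(** The residual of a quasimode lies in the unit ball and is mapped to U, so the resolvent has norm
    at least K lambda^(1/2); the weight leaves K lambda^eps. *)
Lemma resolvent_unbounded (eps Lambda : R) : 0 < eps ->
  ereal_sup [set ((`|lambda| `^ (eps - 2^-1))%R%:E
      * opnorm N (resolvent_graph E N D A (0%R +i* lambda)%C))%E
    | lambda in [set lambda : R | Lambda <= `|lambda|]] = +oo%E.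
Proof.
move=> eps0; apply/eqyP => C C0.
have [x0 Hx0] := powR_unbounded (C / K) eps0.
have [lambda [U [lam [DU EU EAU NF NU]]]] :=
  quasimodes (Num.max (Num.max Lambda x0) 1).
move: lam; rewrite !ge_max => /andP[/andP[lam1 lam2] lam3].
have l0 : 0 < lambda by exact: lt_le_trans lam3.
have EF : E ((0 +i* lambda)%C *: U - A U) by apply: EB => //; exact: EZ.
apply: ereal_sup_ge; exists (((`|lambda| `^ (eps - 2^-1))%R%:E
      * opnorm N (resolvent_graph E N D A (0%R +i* lambda)%C))%E).
  by exists lambda => //=; rewrite gtr0_norm.
rewrite gtr0_norm //.
have op : ((N U)%:E <= opnorm N (resolvent_graph E N D A (0%R +i* lambda)%C))%E.
  apply: ereal_sup_ubound; exists ((0 +i* lambda)%C *: U - A U, U) => //=.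
  by split=> //; split=> //=; rewrite subrr; exact: N0 EU.
apply: (@le_trans _ _ ((lambda `^ (eps - 2^-1))%:E * (K * Num.sqrt lambda)%:E)%E).
  rewrite -EFinM lee_fin mulrCA -powR12_sqrt ?(ltW l0) // -powRD; last first.
    by apply/implyP => _; rewrite gt_eqF.
  by rewrite subrK mulrC -ler_pdivrMr // ltW // Hx0.
apply: lee_pmul => //.
- by rewrite lee_fin powR_ge0.
- by rewrite lee_fin mulr_ge0 ?(ltW K_gt0) // sqrtr_ge0.
- by apply: le_trans op; rewrite lee_fin.
Qed.

End resolvent.

Variable T : R -> X -> X.
Hypothesis cT : contraction_C0_semigroup E N T.
Hypothesis gT : generates E N D A T.

(* This replaces Duhamel's formula. *)
Let deviation_subadditive (lambda : R) U s t : E U -> 0 <= s -> 0 <= t ->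
  N (T (s + t) U - cis (lambda * (s + t)) *: U) <=
  N (T s U - cis (lambda * s) *: U) + N (T t U - cis (lambda * t) *: U).
Proof.
move=> EU s0 t0; case: cT => TE Tlin _ Tadd _.
have st0 : 0 <= s + t by rewrite addr_ge0.
have ETs V : E V -> E (T s V) by move=> EV; case: (TE s V s0 EV).
have ETt : E (T t U) by case: (TE t U t0 EU).
have ETst : E (T (s + t) U) by case: (TE (s + t) U st0 EU).
set c := cis (lambda * t).
pose Z := (- c) *: U + T t U.
have EZZ : E Z by exact: E_lin.
(* [A1] and [A2] have seminorm zero: the semigroup law and linearity hold only modulo [N]. Up to
   them the deviation at [s + t] is T s applied to the deviation at [t], which is contracted, plus a
   unimodular multiple of the deviation at [s]. *)
pose A1 := T (s + t) U - T s (T t U).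
pose A2 := T s Z - ((- c) *: T s U + T s (T t U)).
pose B := T s U - cis (lambda * s) *: U.
have EA1 : E A1 by apply: EB => //; exact: ETs.
have EA2 : E A2 by apply: EB; [exact: ETs | apply: E_lin; exact: ETs].
have EBB : E B by apply: EB; [exact: ETs | exact: EZ].
have NA1 : N A1 = 0 by exact: Tadd.
have NA2 : N (- A2) = 0 by rewrite NN //; exact: Tlin.
have -> : T (s + t) U - cis (lambda * (s + t)) *: U =
   (A1 - A2) + (T s Z + c *: B).
  rewrite mulrDr cisD mulrC -/c /A1 /A2 /B scalerBr scalerA scaleNr.
  rewrite opprB !addrA; congr (_ - _).
  by rewrite subrK [_ - c *: _ + _]addrAC !subrK.
have EA12 : E (A1 - A2) by exact: EB.
have EZB : E (T s Z + c *: B) by apply: ED; [exact: ETs | exact: EZ].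
apply: (le_trans (ND EA12 EZB)).
have H1 := ND EA1 (EN EA2); rewrite NA1 NA2 addr0 in H1.
have H2 := ND (ETs _ EZZ) (EZ c EBB).
rewrite NZ // sqmod_cis sqrtr1 mul1r in H2.
have H3 : N (T s Z) <= N Z by case: (TE s Z s0 EZZ).
have H4 : N Z = N (T t U - c *: U) by rewrite /Z scaleNr addrC.
lra.
Qed.

(** Cut [0, t] into n equal steps: by subadditivity the deviation at t is at most n times the one at
    t / n, and for large n the latter is t / n times the residual, up to a relative error that tends
    to 0. *)
Lemma semigroup_quasimode_deviation (lambda t : R) U :
  D U -> E U -> E (A U) -> 0 <= t ->
  N (T t U - cis (lambda * t) *: U) <= t * N (A U - (0 +i* lambda)%C *: U).
Proof.
move=> DU EU EAU t0.
pose G s := N (T s U - cis (lambda * s) *: U).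
have G0 : G 0 = 0.
  by rewrite /G mulr0 cis0 scale1r; case: cT => _ _ H _ _; exact: H.
have Gn n s : 0 <= s -> G (s *+ n) <= G s *+ n.
  move=> s0; elim: n => [|n IH]; first by rewrite !mulr0n G0.
  rewrite !mulrS; apply: le_trans (deviation_subadditive lambda EU s0 _) _.
    by rewrite mulrn_wge0.
  by rewrite lerD2l.
have limA : N ((h^-1)%:C%C *: (T h U - U) - A U) @[h --> 0^'+] --> (0 : R).
  by apply/(gT EU EAU); split=> //; rewrite subrr (N0 EU).
set K := N (A U - (0 +i* lambda)%C *: U).
have EK : E (A U - (0 +i* lambda)%C *: U) by apply: EB => //; exact: EZ.
move: t0; rewrite le_eqVlt => /predU1P[<-|t0].
  by rewrite mul0r -/(G 0) G0.
(* One [e] comes from the difference quotient of the semigroup, and [e * N U] from that of [cis]. *)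
suff H e : 0 < e -> G t <= t * (K + e * (1 + N U)).
  apply/ler_addgt0Pr => e e0; rewrite -/(G t).
  have NU0 : 0 <= `|N U| by [].
  have q0 : 0 < t * (1 + `|N U|) by rewrite mulr_gt0 // ltr_wpDr.
  apply: (le_trans (H (e / (t * (1 + `|N U|))) (divr_gt0 e0 q0))).
  rewrite mulrDr lerD2l mulrCA -[leRHS](@divfK _ (t * (1 + `|N U|))) ?gt_eqF //.
  rewrite ler_wpM2l ?(ltW (divr_gt0 e0 q0)) // ler_wpM2l ?(ltW t0) //.
  by rewrite lerD2l ler_norm.
move=> e0.
have small : \forall h \near 0^'+, 0 < h /\ G h <= h * (K + e * (1 + N U)).
  near=> h.
  have h0 : 0 < h by near: h; exact: nbhs_right_gt.
  split=> //.
  have H1 : N ((h^-1)%:C%C *: (T h U - U) - A U) <= e.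
    apply: ltW; rewrite -[X in X < _]subr0; apply: le_lt_trans (ler_norm _) _.
    by rewrite distrC; near: h; move: limA => /cvgrPdist_lt; apply.
  have H2 : sqmod ((h^-1)%:C%C * (1 - cis (lambda * h)) + (0 +i* lambda)%C) <= e ^+ 2.
    by near: h; exact: cis_derive.
  have H3 : Num.sqrt (sqmod ((h^-1)%:C%C * (1 - cis (lambda * h)) + (0 +i* lambda)%C)) <= e.
    by rewrite -[leRHS](ger0_norm (ltW e0)) -sqrtr_sqr ler_wsqrtr.
  have ETh : E (T h U) by case: cT => TE _ _ _ _; case: (TE h U (ltW h0) EU).
  set c := _ + (0 +i* lambda)%C in H2 H3.
  pose V := (h^-1)%:C%C *: (T h U - U) - A U.
  have EV : E V by apply: EB => //; apply: EZ; exact: EB.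
  have e1 : T h U - cis (lambda * h) *: U =
     h%:C%C *: (V + ((A U - (0 +i* lambda)%C *: U) + c *: U)).
    have hh : h%:C%C * (h^-1)%:C%C = 1.
      by apply: eq_complexP; rewrite ?ReM ?ImM /=; [field; rewrite gt_eqF | ring].
    rewrite /V /c scalerDl [_ + (A U - _ + _)]addrA [_ - A U + _]addrA subrK.
    rewrite addrA [_ - _ *: U + _]addrAC subrK -scalerA -scalerDr scalerA hh.
    by rewrite scale1r scalerBl scale1r addrA subrK.
  rewrite /G e1 NZ; last by apply: ED => //; apply: ED => //; exact: EZ.
  have -> : Num.sqrt (sqmod h%:C%C) = h.
    by rewrite /sqmod /= expr0n addr0 sqrtr_sqr gtr0_norm.
  rewrite ler_wpM2l ?(ltW h0) //.
  have NU0 := N_ge0 EU.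
  have EcU := EZ c EU.
  have := ND EV (ED EK EcU); have := ND EK EcU; rewrite NZ // -/K -/V in H1 *.
  have := ler_wpM2r NU0 H3.
  lra.
have [n nsmall] : exists n : nat, 0 < t / n.+1%:R /\
    G (t / n.+1%:R) <= t / n.+1%:R * (K + e * (1 + N U)).
  have /nbhs_ballP[d /= d0 Hd] : \forall h \near (0 : R),
      0 < h -> 0 < h /\ G h <= h * (K + e * (1 + N U)) by exact: small.
  have q0 n : 0 < t / n.+1%:R by rewrite divr_gt0.
  exists (Num.truncn (t / d)); apply: Hd => //.
  rewrite /ball /= sub0r normrN gtr0_norm // ltr_pdivrMr // mulrC.
  by rewrite -ltr_pdivrMr // truncnS_gt.
have [q0 Gq] := nsmall.
have -> : t = (t / n.+1%:R) *+ n.+1 by rewrite -[RHS]mulr_natr divfK // pnatr_eq0.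
apply: le_trans (Gn _ _ (ltW q0)) _.
by rewrite mulrnAl lerMn2r Gq orbT.
Unshelve. all: by end_near. Qed.

Lemma decay_rate_le2 (K gamma : R) : 0 < K ->
  (forall Lambda : R, exists lambda U,
    Lambda <= lambda /\ quasimode K lambda U) ->
  decay_estimate N D A T gamma -> gamma <= 2.
Proof.
move=> K_gt0 quasimodes [M M0 dec]; rewrite leNgt; apply/negP => g2.
have K2 : 0 < K / 2 by rewrite divr_gt0.
have K2g : 0 < (K / 2) `^ gamma by exact: powR_gt0.
(* The decay estimate will give (K/2 s)^gamma <= 2 M (2 + 1/K) s^2 with s^2 = lambda; dividing by
   (K/2)^gamma s^2 yields s^(gamma - 2) <= C, which fails for large s. *)
pose C := 2 * M * (2 + K^-1) / (K / 2) `^ gamma.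
have [x0 Hx0] : exists x0 : R, forall x, x0 <= x -> C < x `^ (gamma - 2).
  by apply: powR_unbounded; rewrite subr_gt0.
have [lambda [U [lam [DU EU EAU NF NU]]]] :=
  quasimodes (Num.max (Num.max 0 x0 ^+ 2) 1).
move: lam; rewrite ge_max => /andP[lam1 lam2].
have l0 : 0 < lambda by exact: lt_le_trans lam2.
pose s : R := Num.sqrt lambda.
have s1 : 1 <= s by rewrite -(sqrtr1 R) ler_wsqrtr.
have sx0 : x0 <= s.
  apply: (@le_trans _ _ (Num.max 0 x0)); first by rewrite le_max lexx orbT.
  rewrite -[leLHS]ger0_norm ?le_max ?lexx // -sqrtr_sqr; exact: ler_wsqrtr.
have ss : s ^+ 2 = lambda by rewrite sqr_sqrtr // ltW.
have Hs := Hx0 s sx0.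
have s0 : 0 < s by exact: lt_le_trans s1.
rewrite -/s in NU.
(* The residual is at most 1, so up to this time the deviation is at most K s / 2, half of the
   guaranteed lower bound for [N U]. *)
pose t : R := K / 2 * s.
have t0 : 0 < t by rewrite mulr_gt0.
have EiU : E ((0 +i* lambda)%C *: U) by exact: EZ.
have ER := EB EAU EiU.
have NR : N (A U - (0 +i* lambda)%C *: U) <= 1.
  by rewrite -opprB NN //; exact: EB.
have dev := semigroup_quasimode_deviation lambda DU EU EAU (ltW t0).
have {}dev : N (T t U - cis (lambda * t) *: U) <= t.
  by apply: (le_trans dev); rewrite ler_piMr // ltW.
have ETt : E (T t U) by case: cT => TE _ _ _ _; case: (TE t U (ltW t0) EU).
have EcU : E (cis (lambda * t) *: U) by exact: EZ.
have NTt : N U / 2 <= N (T t U).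
  have := ND ETt (EN (EB ETt EcU)); rewrite NN; last exact: EB.
  rewrite opprB addrC subrK NZ // sqmod_cis sqrtr1 mul1r.
  by move: dev NU; rewrite /t; lra.
have NAU : N (A U) <= 1 + lambda * N U.
  have := ND ER EiU; rewrite subrK NZ //.
  have -> : Num.sqrt (sqmod (0 +i* lambda)%C) = lambda.
    by rewrite /sqmod /= expr0n add0r sqrtr_sqr gtr0_norm.
  by move=> H; apply: (le_trans H); rewrite lerD2r.
have := dec U t DU (ltW t0).
have P0 : 0 < (1 + t) `^ gamma by rewrite powR_gt0 // ltr_wpDl.
have tP : t `^ gamma <= (1 + t) `^ gamma.
  apply: ge0_ler_powR; rewrite ?nnegrE; last by rewrite lerDr.
  - by apply: ltW; apply: lt_trans g2.
  - exact: ltW.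
  - by rewrite addr_ge0 // ltW.
have tE : t `^ gamma = (K / 2) `^ gamma * (s `^ (gamma - 2) * lambda).
  rewrite /t (powRM _ (ltW K2) (ltW s0)); congr (_ * _).
  rewrite -ss -powR_mulrn ?(ltW s0) // -powRD ?subrK //.
  by apply/implyP => _; rewrite gt_eqF.
move=> {}dec.
have NU0 : 0 < N U.
  by apply: lt_le_trans NU; rewrite mulr_gt0.
have K1 : K <= N U by apply: le_trans NU; rewrite ler_peMr // ltW.
have invK : 1 <= N U * K^-1 by rewrite ler_pdivlMr // mul1r.
have Ki0 : 0 < K^-1 by rewrite invr_gt0.
(* The constant term 1 in the bound for [N (A U)] is absorbed through 1 <= N U / K. *)
have sumle : N U + N (A U) <= N U * ((2 + K^-1) * lambda).
  have h1 : N U * K^-1 <= N U * K^-1 * lambda.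
    by rewrite ler_peMr // mulr_ge0 // ltW.
  have h2 : N U <= N U * lambda by rewrite ler_peMr // ltW.
  have -> : N U * ((2 + K^-1) * lambda) = N U * lambda + lambda * N U + N U * K^-1 * lambda.
    by ring.
  by lra.
have H1 : N U / 2 <= M / (1 + t) `^ gamma * (N U * ((2 + K^-1) * lambda)).
  apply: (le_trans NTt); apply: (le_trans dec); rewrite ler_wpM2l //.
  by rewrite divr_ge0 // ltW.
have H2 : (1 + t) `^ gamma <= 2 * M * (2 + K^-1) * lambda.
  move: H1; rewrite mulrAC ler_pdivlMr // mulrC => H1.
  have : N U * (1 + t) `^ gamma <= N U * (2 * M * (2 + K^-1) * lambda).
    by move: H1; set P := _ `^ _; lra.
  by rewrite ler_pM2l.
have : C * lambda < s `^ (gamma - 2) * lambda by rewrite ltr_pM2r.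
rewrite ltNge => /negP; apply.
rewrite /C mulrAC ler_pdivlMr // mulrC -tE.
exact: le_trans tP H2.
Qed.

End seminorm.

(** * The undamped wave and its boundary layer *)

Section oscillation.
Context {R : realType}.
Variables (k : R) (delta : R[i]).

(* [sin (k x)] with its frequency perturbed to first order by [delta] *)
Definition osc (x : R) : R[i] :=
  (sin (k * x))%:C%C + delta * (x * cos (k * x))%:C%C.

Definition osc1 (x : R) : R[i] :=
  (k * cos (k * x))%:C%C + delta * (cos (k * x) - k * x * sin (k * x))%:C%C.

Definition osc2 (x : R) : R[i] :=
  (- (k ^+ 2 * sin (k * x)))%:C%C
  + delta * (- (2 * k * sin (k * x) + k ^+ 2 * x * cos (k * x)))%:C%C.

Let C1_lin : C1_derive (fun x : R => k * x) (fun=> k).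
Proof.
apply: C1_derive_eq (C1_deriveM (C1_derive_cst k) C1_derive_id) => x.
by rewrite mul0r add0r mulr1.
Qed.

Let C1_sinl : C1_derive (fun x : R => sin (k * x)) (fun x => k * cos (k * x)).
Proof.
by apply: C1_derive_eq (C1_derive_comp C1_derive_sin C1_lin) => x; exact: mulrC.
Qed.

Let C1_cosl : C1_derive (fun x : R => cos (k * x)) (fun x => - (k * sin (k * x))).
Proof.
apply: C1_derive_eq (C1_derive_comp C1_derive_cos C1_lin) => x.
by rewrite mulNr mulrC.
Qed.

Lemma C1_cderive_osc : C1_cderive osc osc1.
Proof.
apply: C1_cderiveD; first exact: C1_cderive_real C1_sinl.
apply: C1_cderiveZ; apply: C1_cderive_real.
by apply: C1_derive_eq (C1_deriveM C1_derive_id C1_cosl) => x; ring.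
Qed.

Lemma C1_cderive_osc1 : C1_cderive osc1 osc2.
Proof.
apply: C1_cderiveD.
  apply: C1_cderive_real.
  by apply: C1_derive_eq (C1_deriveM (C1_derive_cst k) C1_cosl) => x; ring.
apply: C1_cderiveZ; apply: C1_cderive_real.
apply: C1_derive_eq (C1_deriveB C1_cosl (C1_deriveM C1_lin C1_sinl)) => x.
by ring.
Qed.

Lemma osc_0 : osc 0 = 0.
Proof. by rewrite /osc mulr0 sin0 mul0r mulr0 addr0. Qed.

(** Resonance: applied to x cos (k x), the operator k^2 + d^2/dx^2 leaves only - 2 k sin (k x), one
    power of k instead of two. *)
Lemma osc_residual x :
  (k ^+ 2)%:C%C * osc x + osc2 x = - (2 * k * sin (k * x))%:C%C * delta.
Proof.
rewrite /osc /osc2; case: delta => d1 d2.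
by apply: eq_complexP; rewrite !(ReD, ImD, ReM, ImM) /=; ring.
Qed.

Lemma sqmod_osc_residual_le x :
  sqmod ((k ^+ 2)%:C%C * osc x + osc2 x) <= 4 * k ^+ 2 * sqmod delta.
Proof.
rewrite osc_residual sqmodM sqmodN ler_wpM2r ?sqmod_ge0 //.
rewrite /sqmod /= expr0n addr0 !exprMn.
have := sqr_ge0 (cos (k * x)); have := cos2Dsin2 (k * x).
have := sqr_ge0 k; nra.
Qed.

(** For [delta = 0] the right side is exactly [k ^+ 2]. The perturbation takes away at most half of
    it and [rev] loses a factor 2, whence the quarter. *)
Lemma sqmod_osc_ge r x : 1 <= k -> 0 <= x <= r ->
  sqmod delta * (3 * r ^+ 2 + 2) <= 4^-1 ->
  k ^+ 2 / 4 <= sqmod (osc1 x) + k ^+ 2 * sqmod (osc x).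
Proof.
move=> k1 /andP[x0 xr] small.
have d0 := sqmod_ge0 delta; set d := sqmod delta in small d0.
set C := cos (k * x); set S := sin (k * x).
have CS : C ^+ 2 + S ^+ 2 = 1 := cos2Dsin2 (k * x).
have k0 : 0 < k by exact: lt_le_trans k1.
have rev (z w : R[i]) : sqmod z <= 2 * sqmod (z + w) + 2 * sqmod w.
  by have := sqmodD_le2 (z + w) (- w); rewrite addrK sqmodN.
have real_sqmod (r0 : R) : sqmod r0%:C%C = r0 ^+ 2.
  by rewrite /sqmod /= expr0n addr0.
have H0 := rev (S%:C%C) (delta * (x * C)%:C%C).
have H1 := rev ((k * C)%:C%C) (delta * (C - k * x * S)%:C%C).
rewrite -/(osc x) sqmodM -/d !real_sqmod in H0.
rewrite -/(osc1 x) sqmodM -/d !real_sqmod in H1.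
have k2 : 1 <= k ^+ 2 by rewrite exprn_ege1.
have B1 : k ^+ 2 * (x * C) ^+ 2 + (C - k * x * S) ^+ 2 <= k ^+ 2 * (3 * r ^+ 2 + 2).
  have C2 : C ^+ 2 <= 1 by have := sqr_ge0 S; lra.
  have S2 : S ^+ 2 <= 1 by have := sqr_ge0 C; lra.
  have xr2 : x ^+ 2 <= r ^+ 2 by rewrite lerXn2r ?nnegrE // (le_trans x0).
  have e1 : (x * C) ^+ 2 <= r ^+ 2.
    by rewrite exprMn; have := sqr_ge0 x; have := sqr_ge0 C; nra.
  have e2 : (x * S) ^+ 2 <= r ^+ 2.
    by rewrite exprMn; have := sqr_ge0 x; have := sqr_ge0 S; nra.
  have e3 : (C - k * x * S) ^+ 2 <= 2 * C ^+ 2 + 2 * k ^+ 2 * (x * S) ^+ 2.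
    have -> : 2 * C ^+ 2 + 2 * k ^+ 2 * (x * S) ^+ 2 =
      (C - k * x * S) ^+ 2 + (C + k * x * S) ^+ 2 by ring.
    by rewrite lerDl sqr_ge0.
  by nra.
have : d * (k ^+ 2 * (x * C) ^+ 2 + (C - k * x * S) ^+ 2) <= k ^+ 2 / 4.
  apply: (le_trans (ler_wpM2l d0 B1)).
  by rewrite mulrCA ler_wpM2l ?sqr_ge0.
have : k ^+ 2 * S ^+ 2 <= k ^+ 2 * (2 * sqmod (osc x) + 2 * (d * (x * C) ^+ 2)).
  by rewrite ler_wpM2l ?sqr_ge0.
have : k ^+ 2 * C ^+ 2 + k ^+ 2 * S ^+ 2 = k ^+ 2 by rewrite -mulrDr CS mulr1.
move: H1; rewrite (exprMn 2 k C).
set sx := sqmod (osc x); set s1 := sqmod (osc1 x); lra.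
Qed.

End oscillation.

Section layer.
Context {R : realType}.
Variables (alpha m s : R).
Hypotheses (m_gt0 : 0 < m) (s_gt0 : 0 < s).

(** Its square is 2 i s^2, which is i lambda / a when lambda = 2 a s^2: the decay rate for the
    leading-order equation lambda^2 u + i lambda a u'' = 0. *)
Definition layer_rate : R[i] := (s +i* s)%C.

(** The complex exponential of - [layer_rate] (x - alpha). *)
Definition layer_exp (x : R) : R[i] :=
  (expR (- (s * (x - alpha))) * cos (s * (x - alpha))
   +i* - (expR (- (s * (x - alpha))) * sin (s * (x - alpha))))%C.

(* [(1 - y^2)^2] with [y = (x - alpha) / m], and its first two derivatives *)
Definition cutoff (x : R) : R := (1 - ((x - alpha) / m) ^+ 2) ^+ 2.

Definition cutoff1 (x : R) : R :=
  - (4 * ((x - alpha) / m) * (1 - ((x - alpha) / m) ^+ 2) / m).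

Definition cutoff2 (x : R) : R := (12 * ((x - alpha) / m) ^+ 2 - 4) / m ^+ 2.

Definition layer (x : R) : R[i] := (cutoff x)%:C%C * layer_exp x.

Definition layer1 (x : R) : R[i] :=
  ((cutoff1 x)%:C%C - layer_rate * (cutoff x)%:C%C) * layer_exp x.

Definition layer2 (x : R) : R[i] :=
  ((cutoff2 x)%:C%C - 2 * layer_rate * (cutoff1 x)%:C%C
   + layer_rate ^+ 2 * (cutoff x)%:C%C) * layer_exp x.

Let C1_shift : C1_derive (fun x : R => x - alpha) (fun=> 1).
Proof.
apply: C1_derive_eq (C1_deriveB C1_derive_id (C1_derive_cst alpha)) => x.
by rewrite subr0.
Qed.

Let C1_sshift : C1_derive (fun x : R => s * (x - alpha)) (fun=> s).
Proof.
apply: C1_derive_eq (C1_deriveM (C1_derive_cst s) C1_shift) => x.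
by rewrite mul0r add0r mulr1.
Qed.

Lemma C1_cderive_layer_exp :
  C1_cderive layer_exp (fun x => - layer_rate * layer_exp x).
Proof.
have de := C1_derive_comp C1_derive_expR (C1_deriveN C1_sshift).
have dc := C1_derive_comp C1_derive_cos C1_sshift.
have ds := C1_derive_comp C1_derive_sin C1_sshift.
split.
  by apply: C1_derive_eq (C1_deriveM de dc) => x; rewrite ReM /=; ring.
apply: C1_derive_eq (C1_deriveN (C1_deriveM de ds)) => x.
by rewrite ImM /=; ring.
Qed.

Let C1_scaled : C1_derive (fun x : R => (x - alpha) / m) (fun=> m^-1).
Proof.
apply: C1_derive_eq (C1_deriveM C1_shift (C1_derive_cst m^-1)) => x.
by rewrite mulr0 addr0 mul1r.
Qed.

Lemma C1_derive_cutoff : C1_derive cutoff cutoff1.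
Proof.
have dq := C1_deriveB (C1_derive_cst 1) (C1_deriveM C1_scaled C1_scaled).
by apply: C1_derive_eq (C1_deriveM dq dq) => x; rewrite /cutoff1; ring.
Qed.

Lemma C1_derive_cutoff1 : C1_derive cutoff1 cutoff2.
Proof.
have dq := C1_deriveB (C1_derive_cst 1) (C1_deriveM C1_scaled C1_scaled).
have d4 := C1_deriveM (C1_derive_cst 4) C1_scaled.
have := C1_deriveN (C1_deriveM (C1_deriveM d4 dq) (C1_derive_cst m^-1)).
apply: C1_derive_eq => x; rewrite /cutoff2; field.
by rewrite gt_eqF.
Qed.

Lemma C1_cderive_layer : C1_cderive layer layer1.
Proof.
apply: C1_cderive_eq
  (C1_cderiveM (C1_cderive_real C1_derive_cutoff) C1_cderive_layer_exp) => x.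
by rewrite /layer1; ring.
Qed.

Lemma C1_cderive_layer1 : C1_cderive layer1 layer2.
Proof.
have dc := C1_cderive_real C1_derive_cutoff.
have dc1 := C1_cderive_real C1_derive_cutoff1.
apply: C1_cderive_eq (C1_cderiveM (C1_cderiveB dc1
  (C1_cderiveZ layer_rate dc)) C1_cderive_layer_exp) => x.
by rewrite /layer2; ring.
Qed.

(** At [alpha] the cutoff is 1 with zero slope, so the layer has the value and slope of the pure
    exponential. *)
Lemma layer_left : layer alpha = 1 /\ layer1 alpha = - layer_rate.
Proof.
rewrite /layer /layer1 /layer_exp /cutoff /cutoff1 subrr mulr0 oppr0 expR0.
rewrite cos0 sin0 mul0r expr0n /= subr0 !mulr0 expr1n !mul0r oppr0.
by split; apply: eq_complexP; rewrite !(ReM, ImM, ReB, ImB) /=; ring.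
Qed.

(** The double zero of the cutoff makes both displacement and stress continuous with the zero
    profile beyond [alpha + m]. *)
Lemma layer_right : layer (alpha + m) = 0 /\ layer1 (alpha + m) = 0.
Proof.
rewrite /layer /layer1 /cutoff /cutoff1 addrAC subrr add0r divff ?gt_eqF //.
by rewrite expr1n subrr expr0n /= mulr0 mul0r oppr0 mulr0 subrr !mul0r.
Qed.

Lemma sqmod_layer_exp x : sqmod (layer_exp x) = expR (- (s * (x - alpha))) ^+ 2.
Proof.
rewrite /sqmod /= sqrrN !exprMn -mulrDr.
by rewrite cos2Dsin2 mulr1.
Qed.

(* [lambda = 2 a s^2] makes the rate an approximate root of
   [(p1 + i lambda a) r^2 + lambda^2], up to the term [2 i p1 s^2]. *)
Lemma layer_residual (p1 a x : R) :
  let lambda := 2 * a * s ^+ 2 in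
  (lambda ^+ 2)%:C%C * layer x + (p1 +i* (lambda * a))%C * layer2 x =
  ((p1 +i* (lambda * a))%C * ((cutoff2 x)%:C%C - 2 * layer_rate * (cutoff1 x)%:C%C)
   + (0 +i* (2 * p1 * s ^+ 2))%C * (cutoff x)%:C%C) * layer_exp x.
Proof.
move=> lambda.
have -> : (0 +i* (2 * p1 * s ^+ 2))%C =
    (lambda ^+ 2)%:C%C + (p1 +i* (lambda * a))%C * layer_rate ^+ 2.
  by rewrite expr2 /lambda; apply: eq_complexP;
    rewrite !(ReD, ImD, ReM, ImM) /= ; ring.
by rewrite /layer /layer2; ring.
Qed.

(** The critical term is [layer_rate * cutoff1], which carries a factor s. Since [cutoff1] contains
    the factor x - alpha, the exponential absorbs it: z exp (- z) <= 1 for z = s (x - alpha). The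
    other terms are bounded uniformly in s, apart from the prefactors of order lambda. *)
Lemma sqmod_layer_residual_le (p1 a x : R) :
  let lambda := 2 * a * s ^+ 2 in
  0 < a -> 1 <= lambda -> alpha <= x <= alpha + m ->
  sqmod ((lambda ^+ 2)%:C%C * layer x + (p1 +i* (lambda * a))%C * layer2 x) <=
  lambda ^+ 2 * (768 * (p1 ^+ 2 + a ^+ 2) / m ^+ 4 + 2 * p1 ^+ 2 / a ^+ 2).
Proof.
move=> lambda a0 l1 /andP[x0 xm]; rewrite layer_residual -/lambda.
rewrite sqmodM sqmod_layer_exp.
pose y : R := (x - alpha) / m.
have y0 : 0 <= y by rewrite divr_ge0 ?subr_ge0 // ltW.
have y1 : y <= 1 by rewrite ler_pdivrMr // mul1r lerBlDl.
set e := expR _.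
have e0 : 0 < e by exact: expR_gt0.
have e1 : e <= 1.
  by rewrite -expR0 ler_expR oppr_le0 mulr_ge0 ?subr_ge0 // ltW.
have see : s * (x - alpha) * e <= 1.
  rewrite /e expRN ler_pdivrMr ?expR_gt0 // mul1r.
  by apply: le_trans (expR_ge1Dx _); rewrite lerDr.
have sy0 : 0 <= s * (x - alpha) * e.
  by rewrite !mulr_ge0 ?subr_ge0 // ltW.
(* Two uses of [sqmodD_le2]. With |12 y^2 - 4| <= 8 and the coefficient 4 of [cutoff1], the constant
   of the statement is 768 = 2 (2 * 64 + 16 * 16). *)
apply: (@le_trans _ _ (2 * ((p1 ^+ 2 + (lambda * a) ^+ 2) *
   (2 * (cutoff2 x ^+ 2 * e ^+ 2) + 16 * (s ^+ 2 * cutoff1 x ^+ 2 * e ^+ 2)))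
   + 8 * p1 ^+ 2 * s ^+ 4 * (cutoff x ^+ 2 * e ^+ 2))).
  have H1 := sqmodD_le2 ((p1 +i* (lambda * a))%C *
      ((cutoff2 x)%:C%C - 2 * layer_rate * (cutoff1 x)%:C%C))
    ((0 +i* (2 * p1 * s ^+ 2))%C * (cutoff x)%:C%C).
  rewrite sqmodM in H1.
  have H2 := sqmodD_le2 ((cutoff2 x)%:C%C) (- (2 * layer_rate * (cutoff1 x)%:C%C)).
  have E1 : sqmod (p1 +i* (lambda * a))%C = p1 ^+ 2 + (lambda * a) ^+ 2 by [].
  have E2 : sqmod ((cutoff2 x)%:C%C) = cutoff2 x ^+ 2.
    by rewrite /sqmod /= expr0n addr0.
  have E3 : sqmod (- (2 * layer_rate * (cutoff1 x)%:C%C)) = 8 * (s ^+ 2 * cutoff1 x ^+ 2).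
    by rewrite sqmodN !sqmodM /sqmod /=; ring.
  have E4 : sqmod ((0 +i* (2 * p1 * s ^+ 2))%C * (cutoff x)%:C%C) =
      4 * p1 ^+ 2 * s ^+ 4 * cutoff x ^+ 2.
    by rewrite sqmodM /sqmod /=; ring.
  rewrite E1 E4 in H1; rewrite E2 E3 in H2.
  have P0 : 0 <= p1 ^+ 2 + (lambda * a) ^+ 2 by rewrite addr_ge0 ?sqr_ge0.
  have H3 := ler_wpM2l P0 H2.
  have ee0 : 0 <= e ^+ 2 by rewrite sqr_ge0.
  apply: (le_trans (ler_wpM2r ee0 H1)).
  have H4 := ler_wpM2r ee0 H3.
  move: H4; set P := p1 ^+ 2 + _; set Q := sqmod _.
  by set c2 := cutoff2 x; set c1 := cutoff1 x; set c := cutoff x; lra.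
have ee1 : e ^+ 2 <= 1 by rewrite exprn_ile1 // ltW.
have m20 : 0 < m ^+ 2 by rewrite exprn_gt0.
have c0 : cutoff x ^+ 2 * e ^+ 2 <= 1.
  have -> : cutoff x ^+ 2 = (1 - y ^+ 2) ^+ 4 by rewrite /cutoff -exprM.
  have q0 : 0 <= 1 - y ^+ 2 by rewrite subr_ge0 exprn_ile1.
  have q1 : 1 - y ^+ 2 <= 1 by rewrite gerBl sqr_ge0.
  by rewrite mulr_ile1 ?exprn_ge0 ?exprn_ile1 // ltW.
have c2 : cutoff2 x ^+ 2 * e ^+ 2 <= 64 / m ^+ 4.
  have -> : cutoff2 x ^+ 2 = (12 * y ^+ 2 - 4) ^+ 2 / m ^+ 4.
    by rewrite /cutoff2 expr_div_n -exprM.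
  rewrite mulrAC ler_pM2r ?invr_gt0 ?exprn_gt0 //.
  have z0 : 0 <= y ^+ 2 by rewrite sqr_ge0.
  have z1 : y ^+ 2 <= 1 by rewrite exprn_ile1.
  have w : (12 * y ^+ 2 - 4) ^+ 2 <= 64 by move: z0 z1; set z := y ^+ 2; nra.
  by have := sqr_ge0 (12 * y ^+ 2 - 4); have := sqr_ge0 e; nra.
have c1 : s ^+ 2 * cutoff1 x ^+ 2 * e ^+ 2 <= 16 / m ^+ 4.
  have -> : s ^+ 2 * cutoff1 x ^+ 2 * e ^+ 2 =
      (s * (x - alpha) * e) ^+ 2 * (1 - y ^+ 2) ^+ 2 * (16 / m ^+ 4).
    by rewrite /cutoff1 /y; field; rewrite gt_eqF.
  rewrite ler_piMl ?divr_ge0 ?exprn_ge0 ?(ltW m_gt0) //.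
  have q0 : 0 <= 1 - y ^+ 2 by rewrite subr_ge0 exprn_ile1.
  have q1 : 1 - y ^+ 2 <= 1 by rewrite gerBl sqr_ge0.
  by rewrite mulr_ile1 ?exprn_ge0 ?exprn_ile1.
have l2 : 1 <= lambda ^+ 2 by rewrite exprn_ege1.
have s4 : 8 * p1 ^+ 2 * s ^+ 4 = lambda ^+ 2 * (2 * p1 ^+ 2 / a ^+ 2).
  by rewrite /lambda; field; rewrite gt_eqF.
have T1 : 8 * p1 ^+ 2 * s ^+ 4 * (cutoff x ^+ 2 * e ^+ 2) <=
    lambda ^+ 2 * (2 * p1 ^+ 2 / a ^+ 2).
  rewrite -s4 ler_piMr // -mulrA mulr_ge0 //.
  by rewrite mulr_ge0 ?exprn_even_ge0.
have T2 : p1 ^+ 2 + (lambda * a) ^+ 2 <= lambda ^+ 2 * (p1 ^+ 2 + a ^+ 2).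
  rewrite mulrDr exprMn lerD2r ler_peMl ?sqr_ge0 //.
have T3 : 2 * (cutoff2 x ^+ 2 * e ^+ 2) + 16 * (s ^+ 2 * cutoff1 x ^+ 2 * e ^+ 2)
    <= 384 / m ^+ 4.
  move: c1 c2; set i4 := (m ^+ 4)^-1; set u := cutoff2 x ^+ 2 * _.
  by set v := s ^+ 2 * _ * _; lra.
have T4 : (p1 ^+ 2 + (lambda * a) ^+ 2) *
   (2 * (cutoff2 x ^+ 2 * e ^+ 2) + 16 * (s ^+ 2 * cutoff1 x ^+ 2 * e ^+ 2)) <=
   (lambda ^+ 2 * (p1 ^+ 2 + a ^+ 2)) * (384 / m ^+ 4).
  apply: ler_pM => //; first by rewrite addr_ge0 ?sqr_ge0.
  have u0 : 0 <= cutoff2 x ^+ 2 * e ^+ 2 by apply: mulr_ge0; exact: sqr_ge0.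
  have v0 : 0 <= s ^+ 2 * cutoff1 x ^+ 2 * e ^+ 2.
    by apply: mulr_ge0; [apply: mulr_ge0|]; exact: sqr_ge0.
  by rewrite addr_ge0 // mulr_ge0.
have -> : lambda ^+ 2 * (768 * (p1 ^+ 2 + a ^+ 2) / m ^+ 4 + 2 * p1 ^+ 2 / a ^+ 2) =
  2 * ((lambda ^+ 2 * (p1 ^+ 2 + a ^+ 2)) * (384 / m ^+ 4))
  + lambda ^+ 2 * (2 * p1 ^+ 2 / a ^+ 2).
  by ring.
by rewrite lerD // ler_wpM2l.
Qed.

End layer.

(** * Gluing the profiles *)

Section glue.
Context {R : realType}.
Notation mu := (@lebesgue_measure R).

Definition glue (alpha beta : R) (f g : R -> R[i]) : cfun R :=
  fun x => if x < alpha then f x else if x < beta then g x else 0.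

(** The scalar 1 gives the sum the shape [c *: f + g] of [is_weak_deriveZD]. *)
Lemma glueE (alpha beta : R) (f g : R -> R[i]) : alpha < beta ->
  glue alpha beta f g = (1 *: (trunc alpha (fun x => f x - g x) : cfun R)
    + (trunc beta g : cfun R)) :> cfun R.
Proof.
move=> ab; apply/funext => x; rewrite /glue /trunc scale1r /GRing.add /=.
case: ltP => xa; last by rewrite add0r.
by rewrite (lt_trans xa ab) subrK.
Qed.

Lemma glue_weak_derive (a b alpha beta : R) (f f' g g' : R -> R[i]) :
  a < alpha -> alpha < beta -> beta <= b ->
  C1_cderive f f' -> C1_cderive g g' -> f alpha = g alpha -> g beta = 0 ->
  [/\ in_L2 a b (glue alpha beta f g), in_L2 a b (glue alpha beta f' g') &
      is_weak_derive a b (glue alpha beta f g) (glue alpha beta f' g')].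
Proof.
move=> aa ab bb df dg fg g0; rewrite !glueE //.
have fg0 : f alpha - g alpha = 0 by rewrite fg subrr.
have [h1 h2 h3] :=
  trunc_weak_derive aa (le_trans (ltW ab) bb) (C1_cderiveB df dg) fg0.
have [k1 k2 k3] := trunc_weak_derive (lt_trans aa ab) bb dg g0.
split; [exact: in_L2D (in_L2Z 1 h1) k1 | exact: in_L2D (in_L2Z 1 h2) k2 |].
exact: is_weak_deriveZD h1 h2 k1 k2 h3 k3.
Qed.

Lemma ae_neq (c : R) : {ae mu, forall x, x <> c}.
Proof.
exists [set c]; split; [exact: measurable_set1 | exact: lebesgue_measure_set1 |].
by move=> x /= /contrapT.
Qed.

Lemma in_L2_real_mul (a b K : R) (r : R -> R) (f : cfun R) :
  measurable_fun (`]a, b[ : set (measurableTypeR R)) r ->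
  (forall x, r x ^+ 2 <= K) -> in_L2 a b f ->
  in_L2 a b (fun x => (r x)%:C%C * f x).
Proof.
move=> mr rK fL; have [fR fJ _] := fL.
have mI : measurable (`]a, b[ : set (measurableTypeR R)) by exact: measurable_itv.
apply: (@in_L2_dominated _ _ _ _ (fun x => K * sqmod (f x))).
- have := measurable_funM mr fR; apply: eq_measurable_fun => x _.
  by rewrite ReM /= mul0r subr0.
- have := measurable_funM mr fJ; apply: eq_measurable_fun => x _.
  by rewrite ImM /= mul0r addr0.
- have := integrableZl mI K (in_L2_integrable fL).
  exact: eq_integrable.
- move=> x _; rewrite sqmodM ler_wpM2r ?sqmod_ge0 //.
  by rewrite /sqmod /= expr0n addr0.
Qed.

Lemma L2sq_0 (a b : R) (f : cfun R) : in_L2 a b f ->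
  {ae mu, forall x, a < x < b -> f x = 0} -> L2sq a b f = 0.
Proof.
move=> fL f0; rewrite (eq_L2sq fL (in_L2_0 a b) f0).
by rewrite -(scale0r (0 : cfun R)) L2sqZ ?sqmod0 ?mul0r //; exact: in_L2_0.
Qed.

End glue.

Section glued_state.
Context {R : realType}.
Notation mu := (@lebesgue_measure R).
Variables l L p1 p2 a alpha beta lambda : R.
Hypotheses (p1_gt0 : 0 < p1) (p2_gt0 : 0 < p2) (alpha_gt0 : 0 < alpha)
  (alpha_lt_beta : alpha < beta) (beta_lt_l : beta < l).
Variables f f1 f2 g g1 g2 : R -> R[i].
Hypotheses (df : C1_cderive f f1) (df1 : C1_cderive f1 f2)
  (dg : C1_cderive g g1) (dg1 : C1_cderive g1 g2).
Hypotheses (f_0 : f 0 = 0) (fg : f alpha = g alpha)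
  (g_beta : g beta = 0) (g1_beta : g1 beta = 0)
  (stress_alpha : p1%:C%C * f1 alpha = (p1 +i* (lambda * a))%C * g1 alpha).

Local Notation E := (in_H2 l L).
Local Notation N := (norm_H2 l L p1 p2).
Local Notation D := (domA2 l L p1 p2 a alpha beta).
Local Notation A := (A2 l L p1 p2 a alpha beta).

Let ilam : R[i] := (0 +i* lambda)%C.
Let u : cfun R := glue alpha beta f g.
Let du : cfun R := glue alpha beta f1 g1.
Let S : cfun R := glue alpha beta (fun x => p1%:C%C * f1 x)
  (fun x => (p1 +i* (lambda * a))%C * g1 x).
Let dS : cfun R := glue alpha beta (fun x => p1%:C%C * f2 x)
  (fun x => (p1 +i* (lambda * a))%C * g2 x).
Let w : cfun R * cfun R := (u, 0).

(** With velocity exactly i lambda u, the first component of (i lambda - A) U is zero and the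
    residual is measured in L2 only. *)
Definition glued_state : state R := (w, ilam *: w).

Let l_gt0 : 0 < l.
Proof. by rewrite (lt_trans _ beta_lt_l) // (lt_trans alpha_gt0). Qed.

Let uP : [/\ in_L2 0 l u, in_L2 0 l du & is_weak_derive 0 l u du].
Proof. by apply: glue_weak_derive => //; exact: ltW. Qed.

Let SP : [/\ in_L2 0 l S, in_L2 0 l dS & is_weak_derive 0 l S dS].
Proof.
apply: glue_weak_derive => //; [exact: ltW | exact: C1_cderiveZ | exact: C1_cderiveZ |].
by rewrite g1_beta mulr0.
Qed.

Let u_H1 : in_H1 0 l u.
Proof. by case: uP => uL duL udu; split=> //; exists du. Qed.

Let wdu := weak_derive 0 l u.
Let wdv := weak_derive 0 l (ilam *: u).
Let wd2 := weak_derive l L (0 : cfun R).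

Let wduP : in_L2 0 l wdu /\ {ae mu, forall x, 0 < x < l -> wdu x = du x}.
Proof. by case: uP => uL duL udu; have [h1 _ h3] := weak_deriveP duL udu. Qed.

Let wdvP : in_L2 0 l wdv /\ {ae mu, forall x, 0 < x < l -> wdv x = ilam * du x}.
Proof.
have e : ilam *: u = ilam *: u + 0 by rewrite addr0.
have vH : in_H1 0 l (ilam *: u) by rewrite e; exact: in_H1ZD u_H1 (in_H1_0 _ _).
split; first by have [] := in_H1_weak_derive vH.
have [uL duL udu] := uP.
have dvL := in_L2D (in_L2Z ilam duL) (in_L2_0 0 l).
have [_ _ ] := weak_deriveP dvL (is_weak_deriveZD ilam uL duL (in_L2_0 0 l)
  (in_L2_0 0 l) udu (@is_weak_derive0 R 0 l)).
by rewrite -e; apply: aeS => x H xl; rewrite /wdv H // /GRing.add /= addr0.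
Qed.

(** Even the weak derivative of the zero function is a chosen representative, known to vanish only
    almost everywhere. *)
Let wd2P : in_L2 l L wd2 /\ {ae mu, forall x, l < x < L -> wd2 x = 0}.
Proof. by have [] := weak_deriveP (in_L2_0 l L) (@is_weak_derive0 R l L). Qed.

Let St := stress l p1 a alpha beta u (ilam *: u).

Let St_L2 : in_L2 0 l St.
Proof.
have [h1 _] := wduP; have [h2 _] := wdvP.
apply: in_L2D (in_L2Z p1%:C%C h1) _.
apply: (@in_L2_real_mul _ _ _ (a ^+ 2)) h2.
  apply: measurable_funM; first exact: measurable_cst.
  by apply: measurable_indic; exact: measurable_itv.
move=> x; rewrite /damping indicE exprMn; case: (_ \in _) => /=.
  by rewrite expr1n mulr1.
by rewrite expr0n mulr0 sqr_ge0.
Qed.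

Let St_ae : {ae mu, forall x, 0 < x < l -> St x = S x}.
Proof.
have [_ h1] := wduP; have [_ h2] := wdvP.
(* The point [alpha] is discarded: there [glue] already takes its second branch, while the open
   interval in [damping] excludes it. *)
apply: aeS2 (aeS2 _ h1 h2) (ae_neq alpha); last first.
  by move=> x e1 e2; exact: (conj e1 e2).
move=> x [e1 e2] xa xl; rewrite /St /stress -/wdu -/wdv e1 // e2 //.
rewrite /du /S /glue /damping indicE.
have [xla|axx] := ltP x alpha.
  rewrite memNset ?mulr0 ?mul0r ?addr0 //= in_itv /= => /andP[ax _].
  by move: (lt_trans ax xla); rewrite ltxx.
have [xb|bx] := ltP x beta; last by rewrite !mulr0 addr0.
rewrite mem_set; last first.
  by rewrite /= in_itv /= xb andbT lt_neqAle axx andbT eq_sym; apply/eqP.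
rewrite mulr1 mulrA -mulrDl; congr (_ * _).
by apply: eq_complexP; rewrite !(ReD, ImD, ReM, ImM) /ilam /=; ring.
Qed.

Let St_weak : is_weak_derive 0 l St dS.
Proof.
have [SL dSL SdS] := SP.
apply: (is_weak_derive_ae SL St_L2 dSL dSL _ _ SdS).
  by apply: aeS St_ae => x e /e ->.
exact: aeW.
Qed.

Let wdStP : in_L2 0 l (weak_derive 0 l St) /\
  {ae mu, forall x, 0 < x < l -> weak_derive 0 l St x = dS x}.
Proof. by have [_ dSL _] := SP; have [] := weak_deriveP dSL St_weak. Qed.

Let T2 : cfun R := p2%:C%C *: wd2.

Let T2_L2 : in_L2 l L T2.
Proof. exact: in_L2Z wd2P.1. Qed.

Let wd2_weak : is_weak_derive l L wd2 0.
Proof.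
have O := in_L2_0 l L.
apply: (is_weak_derive_ae O wd2P.1 O O _ _ (@is_weak_derive0 R l L)).
  by apply: aeS wd2P.2 => x e /e ->.
exact: aeW.
Qed.

Let T2_weak : is_weak_derive l L T2 0.
Proof.
have O := in_L2_0 l L.
apply: (is_weak_derive_ae O T2_L2 O O _ _ (@is_weak_derive0 R l L)).
  apply: aeS wd2P.2 => x e /e H.
  by rewrite [RHS](_ : _ = p2%:C%C * wd2 x) // H mulr0.
exact: aeW.
Qed.

Let wdT2P : in_L2 l L (weak_derive l L T2) /\
  {ae mu, forall x, l < x < L -> weak_derive l L T2 x = 0}.
Proof. by have [] := weak_deriveP (in_L2_0 l L) T2_weak. Qed.

Let near_l y : 0 < y < l -> `|y - l| < l - beta -> beta <= y.
Proof. by move=> /andP[_ yl]; rewrite distrC gtr0_norm ?subr_gt0 //; lra. Qed.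

Let glue_near_l (h k : R -> R[i]) y : 0 < y < l -> `|y - l| < l - beta ->
  glue alpha beta h k y = 0.
Proof.
move=> yl yd; have by' := near_l yl yd.
by rewrite /glue !ltNge by' (le_trans (ltW alpha_lt_beta) by').
Qed.

Let w_V2 : in_V2 l L w.
Proof.
split.
- exact: u_H1.
- exact: in_H1_0.
- exists 0; last exact: has_trace0.
  apply: (@has_trace_locally0 _ _ _ _ _ (l - beta)); first by rewrite subr_gt0.
  by apply: aeW => y yl yd; exact: glue_near_l.
- rewrite -f_0; apply: (@has_trace_continuous _ _ _ _ _ _ alpha) => //.
  + move=> y /andP[y0 _]; rewrite subr0 gtr0_norm // => ya.
    by rewrite /w /= /u /glue ya.
  + exact: C1_derive_continuous df.1.
  + exact: C1_derive_continuous df.2.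
- exact: has_trace0.
Qed.

Let v_V2 : in_V2 l L (ilam *: w).
Proof. by rewrite -[_ *: _]addr0; exact: in_V2ZD w_V2 (in_V2_0 _ _). Qed.

Lemma glued_state_in_H2 : E glued_state.
Proof.
split; first exact: w_V2.
by split; [case: v_V2 => [[h _] _ _ _ _] | case: v_V2 => [_ [h _] _ _ _]].
Qed.

Lemma glued_state_in_domA2 : D glued_state.
Proof.
split.
- exact: glued_state_in_H2.
- exact: v_V2.
- by split; [exact: St_L2 | exists dS; [case: SP | exact: St_weak]].
- by split; [exact: wd2P.1 | exists 0; [exact: in_L2_0 | exact: wd2_weak]].
- exists 0.
  + apply: (@has_trace_locally0 _ _ _ _ _ (l - beta)); first by rewrite subr_gt0.
    apply: aeS wduP.2 => y e yl yd.
    rewrite [LHS](_ : _ = p1%:C%C * wdu y) // e // /du glue_near_l //.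
    by rewrite mulr0.
  + apply: (@has_trace_locally0 _ _ _ _ _ 1) => //.
    apply: aeS wd2P.2 => y e yl _.
    by rewrite [LHS](_ : _ = p2%:C%C * wd2 y) // e // mulr0.
Qed.

Lemma A2_glued_state_in_H2 : E (A glued_state).
Proof.
split; first exact: v_V2.
by split; [exact: wdStP.1 | exact: wdT2P.1].
Qed.

Variables B kappa : R.
Hypothesis residual_left : forall x, 0 < x < alpha ->
  sqmod ((lambda ^+ 2)%:C%C * f x + p1%:C%C * f2 x) <= B.
Hypothesis residual_mid : forall x, alpha <= x < beta ->
  sqmod ((lambda ^+ 2)%:C%C * g x + (p1 +i* (lambda * a))%C * g2 x) <= B.
Hypothesis energy_left : forall x, 0 < x < alpha ->
  kappa <= p1 * sqmod (f1 x) + lambda ^+ 2 * sqmod (f x).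

Lemma norm_residual_glued_state :
  N (ilam *: glued_state - A glued_state) <= Num.sqrt (B * l).
Proof.
have EU := glued_state_in_H2; have EAU := A2_glued_state_in_H2.
have ER : E (ilam *: glued_state - A glued_state).
  rewrite addrC -scaleN1r; apply: in_H2ZD EAU _.
  by rewrite -[_ *: _]addr0; exact: in_H2ZD EU (in_H2_0 _ _).
rewrite norm_H2E // ler_wsqrtr //.
have R1 : (ilam *: glued_state - A glued_state).1 = 0 by exact: subrr.
rewrite /energy.
have [dL0 _ d0] := weak_deriveP (in_L2_0 0 l) (@is_weak_derive0 R 0 l).
have -> : L2sq 0 l (weak_derive 0 l (ilam *: glued_state - A glued_state).1.1) = 0.
  by rewrite R1; exact: L2sq_0 d0.
have -> : L2sq l L (weak_derive l L (ilam *: glued_state - A glued_state).1.2) = 0.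
  by rewrite R1; exact: L2sq_0 wd2P.1 wd2P.2.
have [_ [R21 R22]] := ER.
have -> : L2sq l L (ilam *: glued_state - A glued_state).2.2 = 0.
  apply: (L2sq_0 R22); apply: aeS wdT2P.2 => x e /e {}e.
  rewrite [LHS](_ : _ = ilam * (ilam * 0) - weak_derive l L T2 x) //.
  by rewrite e !mulr0 subrr.
rewrite !mulr0 !add0r addr0.
(* [G] replaces the chosen weak derivative of the stress by [dS], so that pointwise bounds apply. It
   equals - (lambda^2 u + dS), the negative of the expression in the residual hypotheses, and is
   zero beyond [beta]. *)
pose G : cfun R := ilam *: (ilam *: u) + (-1) *: dS.
have GL : in_L2 0 l G.
  have [uL _ _] := uP; have [_ dSL _] := SP.
  exact: in_L2D (in_L2Z _ (in_L2Z _ uL)) (in_L2Z _ dSL).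
rewrite (eq_L2sq R21 GL); last first.
  apply: aeS wdStP.2 => x e /e {}e.
  rewrite [LHS](_ : _ = ilam * (ilam * u x) - weak_derive 0 l St x) //.
  rewrite [RHS](_ : _ = ilam * (ilam * u x) + (-1) * dS x) //.
  by rewrite e mulN1r.
have B0 : 0 <= B.
  apply: le_trans (sqmod_ge0 _) (residual_mid (x := alpha) _).
  by rewrite lexx.
have -> : B * l = B * (l - 0) by rewrite subr0.
apply: L2sq_le => //; first exact: ltW.
move=> x /andP[x0 xl].
have lam2 : ilam * ilam = - (lambda ^+ 2)%:C%C.
  by apply: eq_complexP; rewrite !(ReM, ImM) /ilam /=; ring.
have -> : G x = - ((lambda ^+ 2)%:C%C * u x + dS x).
  rewrite [LHS](_ : _ = ilam * (ilam * u x) + (-1) * dS x) //.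
  by rewrite mulrA lam2 mulN1r mulNr opprD.
rewrite sqmodN /u /dS /glue; case: ltP => xa.
  by apply: residual_left; rewrite x0.
case: ltP => xb; first by apply: residual_mid; rewrite xa.
by rewrite mulr0 addr0 sqmod0.
Qed.

Lemma norm_glued_state_ge : Num.sqrt (kappa * alpha) <= N glued_state.
Proof.
have EU := glued_state_in_H2.
rewrite norm_H2E // ler_wsqrtr //.
have [[V1 _ _ _ _] [v1L _]] := EU.
have mI : measurable (`]0, l[ : set (measurableTypeR R)) by exact: measurable_itv.
have e1 : L2sq 0 l wdu = L2sq 0 l du.
  by have [_ duL _] := uP; exact: eq_L2sq wduP.1 duL wduP.2.
apply: (@le_trans _ _ (p1 * L2sq 0 l du + L2sq 0 l glued_state.2.1)); last first.
  rewrite -e1 /energy -/wdu.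
  have h1 := L2sq_ge0 l L (weak_derive l L glued_state.1.2).
  have h2 := L2sq_ge0 l L glued_state.2.2.
  have h3 : 0 <= p2 * L2sq l L (weak_derive l L glued_state.1.2).
    by rewrite mulr_ge0 // ltW.
  rewrite -[leLHS]addr0 lerD // lerD2r.
  by rewrite lerDl.
have [_ duL _] := uP.
have i1 := in_L2_integrable duL; have i2 := in_L2_integrable v1L.
have i1p : mu.-integrable `]0, l[ (EFin \o (fun x => p1 * sqmod (du x))).
  by have := integrableZl mI p1 i1; exact: eq_integrable.
rewrite /L2sq -RintegralZl // -RintegralD //.
have ck : continuous (cst kappa : R -> R) by move=> x; exact: cvg_cst.
have c1 : continuous (cst 1 : R -> R) by move=> x; exact: cvg_cst.
have al : alpha <= l by rewrite (le_trans (ltW alpha_lt_beta)) // ltW.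
(* Only the energy in ]0, alpha[ is kept; written as an integral of a truncated constant over ]0,
   l[, it is compared with the full density in one step. *)
have <- : \int[mu]_(x in `]0, l[) (trunc alpha (cst kappa) x * cst 1 x) = kappa * alpha.
  rewrite (Rintegral_trunc 0 al ck c1).
  under eq_Rintegral do rewrite /= mulr1.
  rewrite Rintegral_cst //= lebesgue_measure_itv /= lte_fin alpha_gt0 -EFinD.
  by rewrite oppr0 addr0.
apply: le_Rintegral => //.
- apply: integrable_mul_continuous => //.
  have ckC : in_L2 0 l (trunc alpha (fun=> kappa%:C%C)).
    by apply: in_L2_trunc => x; exact: cvg_cst.
  have := in_L2_integrable_Re ckC; apply: eq_integrable => // x _.
  by rewrite /= Re_trunc.
- have := integrableD mI i1p i2; exact: eq_integrable.
- move=> x; rewrite /= in_itv /= => /andP[x0 xl]; rewrite mulr1 /trunc.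
  case: ltP => xa; last first.
    by rewrite addr_ge0 ?mulr_ge0 ?sqmod_ge0 ?(ltW p1_gt0).
  have vE : sqmod (glued_state.2.1 x) = lambda ^+ 2 * sqmod (f x).
    rewrite (_ : glued_state.2.1 x = ilam * u x) // sqmodM /u /glue xa.
    by congr (_ * _); rewrite /sqmod /= expr0n add0r.
  apply: (@le_trans _ _ (p1 * sqmod (f1 x) + lambda ^+ 2 * sqmod (f x))).
    by apply: energy_left; rewrite x0.
  by rewrite vE /du /glue xa.
Qed.

End glued_state.

(** * Quasimodes of the transmission problem *)

Section transmission_quasimodes.
Context {R : realType}.
Variables l L p1 p2 a alpha beta : R.
Hypotheses (p1_gt0 : 0 < p1) (p2_gt0 : 0 < p2) (a_gt0 : 0 < a)
  (alpha_gt0 : 0 < alpha) (alpha_lt_beta : alpha < beta) (beta_lt_l : beta < l).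

Local Notation E := (in_H2 l L).
Local Notation N := (norm_H2 l L p1 p2).
Local Notation D := (domA2 l L p1 p2 a alpha beta).
Local Notation A := (A2 l L p1 p2 a alpha beta).

(** [c1] is the wave speed on ]0, alpha[. [Q] is the constant of the layer residual, and [Kg] bounds
    the squared residual on both pieces in units of lambda^2 |delta|^2. [Cd] bounds lambda
    |delta|^2. [W] is what the squared residual must be divided by, its summand 1 keeping it
    positive. *)
Let c1 := Num.sqrt p1.
Let m := beta - alpha.
Let Q := 768 * (p1 ^+ 2 + a ^+ 2) / m ^+ 4 + 2 * p1 ^+ 2 / a ^+ 2.
Let Kg := 4 * p1 + alpha ^+ 2 * Q.
Let Cd := 2 * p1 / (a * alpha ^+ 2).
Let W := Cd * Kg * l + 1.

Let c1_gt0 : 0 < c1. Proof. by rewrite sqrtr_gt0. Qed.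
Let c1_sqr : c1 ^+ 2 = p1. Proof. by rewrite sqr_sqrtr // ltW. Qed.
Let m_gt0 : 0 < m. Proof. by rewrite subr_gt0. Qed.
Let l_gt0 : 0 < l.
Proof. by rewrite (lt_trans _ beta_lt_l) // (lt_trans alpha_gt0). Qed.
Let Q_ge0 : 0 <= Q.
Proof.
have s0 : 0 <= p1 ^+ 2 + a ^+ 2 by rewrite addr_ge0 ?sqr_ge0.
apply: addr_ge0; apply: divr_ge0.
- exact: mulr_ge0 (ler0n _ _) s0.
- exact: exprn_ge0 (ltW m_gt0).
- exact: mulr_ge0 (ler0n _ _) (sqr_ge0 _).
- exact: sqr_ge0.
Qed.
Let Kg_ge0 : 0 <= Kg.
Proof.
apply: addr_ge0; first exact: mulr_ge0 (ler0n _ _) (ltW p1_gt0).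
exact: mulr_ge0 (sqr_ge0 _) Q_ge0.
Qed.
Let Cd_gt0 : 0 < Cd.
Proof. by rewrite divr_gt0 ?mulr_gt0 ?exprn_gt0. Qed.
Let W_gt0 : 0 < W.
Proof.
by apply: ltr_wpDl => //; exact: mulr_ge0 (mulr_ge0 (ltW Cd_gt0) Kg_ge0) (ltW l_gt0).
Qed.

Section mode.
Variables k lambda s : R.
Hypotheses (lambda_k : lambda = c1 * k) (lambda_s : lambda = 2 * a * s ^+ 2).
Hypotheses (s_gt0 : 0 < s) (k_ge1 : 1 <= k) (lambda_ge1 : 1 <= lambda)
  (lambda_large : Cd * (3 * alpha ^+ 2 + 2) * 4 <= lambda).
Hypotheses (cos_alpha : cos (k * alpha) = 1) (sin_alpha : sin (k * alpha) = 0).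

(* the value which makes the stress continuous at [alpha] *)
Let delta : R[i] := - (p1 * k)%:C%C /
  (p1%:C%C + (p1 +i* (lambda * a))%C * layer_rate s * alpha%:C%C).

Let lambda_gt0 : 0 < lambda. Proof. exact: lt_le_trans lambda_ge1. Qed.

(** The imaginary part is a sum of positive terms, whereas the real part may cancel. *)
Let denominator_large : (lambda * a * s * alpha) ^+ 2 <=
  sqmod (p1%:C%C + (p1 +i* (lambda * a))%C * layer_rate s * alpha%:C%C).
Proof.
apply: le_trans (sqr_Im_le _).
have -> : complex.Im (p1%:C%C + (p1 +i* (lambda * a))%C * layer_rate s * alpha%:C%C)
    = p1 * s * alpha + lambda * a * s * alpha.
  by rewrite ImD !(ImM, ReM) /=; ring.
have h1 : 0 <= p1 * s * alpha by rewrite ltW // !mulr_gt0.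
have h2 : 0 <= lambda * a * s * alpha by rewrite ltW // !mulr_gt0.
by rewrite lerXn2r ?nnegrE ?addr_ge0 // lerDr.
Qed.

Let denominator_neq0 :
  p1%:C%C + (p1 +i* (lambda * a))%C * layer_rate s * alpha%:C%C != 0.
Proof.
apply/eqP => e; have := denominator_large; rewrite e sqmod0 leNgt => /negP; apply.
by rewrite exprn_gt0 // !mulr_gt0.
Qed.

(** (p1 k)^2 = p1 lambda^2, while the square of the denominator is at least lambda^2 a^2 s^2 alpha^2
    with s^2 = lambda / (2 a); the quotient is [Cd / lambda]. *)
Let sqmod_delta : sqmod delta <= Cd / lambda.
Proof.
have den_neq0 := denominator_neq0; have den_large := denominator_large.
rewrite /delta; set den := p1%:C%C + _ in den_neq0 den_large *.
set dlt := _ / den.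
have e : dlt * den = - (p1 * k)%:C%C by rewrite divfK.
have {}e : sqmod dlt * sqmod den = (p1 * k) ^+ 2.
  by rewrite -sqmodM e sqmodN /sqmod /= expr0n addr0.
have q0 : 0 < (lambda * a * s * alpha) ^+ 2 by rewrite exprn_gt0 // !mulr_gt0.
rewrite -(ler_pM2r q0).
apply: (@le_trans _ _ (sqmod dlt * sqmod den)).
  by rewrite ler_wpM2l ?sqmod_ge0.
rewrite e le_eqVlt; apply/orP; left; apply/eqP.
have -> : (p1 * k) ^+ 2 = p1 * lambda ^+ 2.
  by rewrite lambda_k !exprMn c1_sqr; ring.
have -> : (lambda * a * s * alpha) ^+ 2 = lambda ^+ 2 * a * alpha ^+ 2 * (lambda / 2).
  by rewrite [in lambda / 2]lambda_s !exprMn; field.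
rewrite /Cd; field; rewrite !gt_eqF //.
Qed.

(** Without this factor the squared residual is at most of order lambda and the squared norm at
    least of order lambda^2; the amplitude brings the residual below 1 and leaves a norm at least of
    order lambda^(1/2). *)
Let amp : R := Num.sqrt (lambda * W)^-1.

Let amp_sqr : amp ^+ 2 = (lambda * W)^-1.
Proof. by rewrite sqr_sqrtr // invr_ge0 mulr_ge0 // ltW. Qed.

(** The value of the wave at [alpha], where the sine vanishes and the cosine is 1. *)
Let mid : R[i] := amp%:C%C * (delta * alpha%:C%C).

Let f x := amp%:C%C * osc k delta x.
Let f1 x := amp%:C%C * osc1 k delta x.
Let f2 x := amp%:C%C * osc2 k delta x.
Let g x := mid * layer alpha m s x.
Let g1 x := mid * layer1 alpha m s x.
Let g2 x := mid * layer2 alpha m s x.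

Let B := amp ^+ 2 * lambda ^+ 2 * sqmod delta * Kg.
Let kappa := amp ^+ 2 * (lambda ^+ 2 / 4).

Let sqmod_amp : sqmod amp%:C%C = amp ^+ 2.
Proof. by rewrite /sqmod /= expr0n addr0. Qed.

Let beta_m : beta = alpha + m. Proof. by rewrite /m addrC subrK. Qed.

(** The constant is the square root of [kappa * alpha / lambda], by the energy bound on ]0,
    alpha[. *)
Lemma quasimode_mode :
  quasimode E N D A (Num.sqrt (alpha / (4 * W))) lambda
    (glued_state alpha beta lambda f g).
Proof.
have df : C1_cderive f f1 by apply: C1_cderiveZ; exact: C1_cderive_osc.
have df1 : C1_cderive f1 f2 by apply: C1_cderiveZ; exact: C1_cderive_osc1.
have dg : C1_cderive g g1 by apply: C1_cderiveZ; exact: C1_cderive_layer.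
have dg1 : C1_cderive g1 g2 by apply: C1_cderiveZ; exact: C1_cderive_layer1.
have ca := cos_alpha; have sa := sin_alpha.
have [layl layl1] := layer_left alpha m s.
have [layr layr1] := layer_right alpha s m_gt0.
have f_0 : f 0 = 0 by rewrite /f osc_0 mulr0.
have fg : f alpha = g alpha.
  by rewrite /f /g /osc layl ca sa mulr1 mulr1 add0r /mid.
have g_beta : g beta = 0 by rewrite /g beta_m layr mulr0.
have g1_beta : g1 beta = 0 by rewrite /g1 beta_m layr1 mulr0.
have stress_alpha : p1%:C%C * f1 alpha = (p1 +i* (lambda * a))%C * g1 alpha.
  rewrite /f1 /g1 /osc1 layl1 ca sa mulr0 subr0 mulr1 /mid.
  (* The equation defining [delta], cleared of its denominator: this is the stress balance divided
     by the amplitude. *)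
  have e : delta * (p1%:C%C + (p1 +i* (lambda * a))%C * layer_rate s * alpha%:C%C)
     = - (p1%:C%C * k%:C%C).
    by rewrite /delta divfK //; apply: eq_complexP; rewrite /= ; ring.
  transitivity (amp%:C%C * (p1%:C%C * k%:C%C + p1%:C%C * delta)).
    by rewrite mulr1; ring.
  rewrite -[p1%:C%C * k%:C%C]opprK -e; ring.
have amp0 : 0 <= amp ^+ 2 by rewrite sqr_ge0.
have d0 := sqmod_ge0 delta.
have q0 : 0 <= amp ^+ 2 * lambda ^+ 2 * sqmod delta.
  exact: mulr_ge0 (mulr_ge0 amp0 (sqr_ge0 _)) d0.
have lam2 : lambda ^+ 2 = p1 * k ^+ 2 by rewrite lambda_k exprMn c1_sqr.
have residual_left x : 0 < x < alpha ->
    sqmod ((lambda ^+ 2)%:C%C * f x + p1%:C%C * f2 x) <= B.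
  move=> _.
  have -> : (lambda ^+ 2)%:C%C * f x + p1%:C%C * f2 x =
      amp%:C%C * (p1%:C%C * ((k ^+ 2)%:C%C * osc k delta x + osc2 k delta x)).
    by rewrite lam2 rmorphM /f /f2 /=; ring.
  rewrite !sqmodM sqmod_amp.
  have -> : sqmod p1%:C%C = p1 ^+ 2 by rewrite /sqmod /= expr0n addr0.
  have H := ler_wpM2l (sqr_ge0 p1) (sqmod_osc_residual_le k delta x).
  apply: (le_trans (ler_wpM2l amp0 H)).
  have -> : amp ^+ 2 * (p1 ^+ 2 * (4 * k ^+ 2 * sqmod delta)) =
     amp ^+ 2 * lambda ^+ 2 * sqmod delta * (4 * p1) by rewrite lam2; ring.
  apply: (ler_wpM2l q0); rewrite /Kg lerDl.
  exact: mulr_ge0 (sqr_ge0 _) Q_ge0.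
have residual_mid x : alpha <= x < beta ->
    sqmod ((lambda ^+ 2)%:C%C * g x + (p1 +i* (lambda * a))%C * g2 x) <= B.
  move=> /andP[ax xb].
  have -> : (lambda ^+ 2)%:C%C * g x + (p1 +i* (lambda * a))%C * g2 x =
      mid * ((lambda ^+ 2)%:C%C * layer alpha m s x
        + (p1 +i* (lambda * a))%C * layer2 alpha m s x).
    by rewrite /g /g2; ring.
  rewrite (sqmodM mid) /mid (sqmodM amp%:C%C) (sqmodM delta) sqmod_amp.
  have -> : sqmod alpha%:C%C = alpha ^+ 2 by rewrite /sqmod /= expr0n addr0.
  have := @sqmod_layer_residual_le R alpha m s m_gt0 s_gt0 p1 a x a_gt0.
  rewrite -lambda_s ax -beta_m (ltW xb) => /(_ lambda_ge1 isT) H.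
  apply: (@le_trans _ _ (amp ^+ 2 * (sqmod delta * alpha ^+ 2) * (lambda ^+ 2 * Q))).
    apply: ler_wpM2l => //.
    exact: mulr_ge0 amp0 (mulr_ge0 d0 (sqr_ge0 _)).
  have -> : amp ^+ 2 * (sqmod delta * alpha ^+ 2) * (lambda ^+ 2 * Q) =
     amp ^+ 2 * lambda ^+ 2 * sqmod delta * (alpha ^+ 2 * Q) by ring.
  apply: (ler_wpM2l q0); rewrite /Kg lerDr.
  exact: mulr_ge0 (ler0n _ _) (ltW p1_gt0).
have energy_left x : 0 < x < alpha ->
    kappa <= p1 * sqmod (f1 x) + lambda ^+ 2 * sqmod (f x).
  move=> /andP[x0 xa].
  have -> : p1 * sqmod (f1 x) + lambda ^+ 2 * sqmod (f x) =
     amp ^+ 2 * (p1 * (sqmod (osc1 k delta x) + k ^+ 2 * sqmod (osc k delta x))).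
    by rewrite /f /f1 !sqmodM sqmod_amp lam2; ring.
  rewrite /kappa ler_wpM2l // lam2 -mulrA ler_wpM2l ?(ltW p1_gt0) //.
  apply: (@sqmod_osc_ge _ _ _ alpha) => //; first by rewrite !ltW.
  have pos : 0 <= 3 * alpha ^+ 2 + 2 by rewrite addr_ge0 // mulr_ge0 ?sqr_ge0.
  (* [lambda_large] is the smallness condition of [sqmod_osc_ge], written through the bound on
     [delta]. *)
  apply: (le_trans (ler_wpM2r pos sqmod_delta)).
  rewrite mulrAC ler_pdivrMr //; have := lambda_large.
  by move: (Cd * (3 * alpha ^+ 2 + 2)) => t; lra.
have Bl : B * l <= 1.
  have : B <= amp ^+ 2 * lambda ^+ 2 * (Cd / lambda) * Kg.
    apply: (ler_wpM2r Kg_ge0); apply: ler_wpM2l => //.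
    exact: mulr_ge0 amp0 (sqr_ge0 _).
  rewrite amp_sqr.
  have -> : (lambda * W)^-1 * lambda ^+ 2 * (Cd / lambda) * Kg = Cd * Kg / W.
    by field; rewrite !gt_eqF.
  move=> /(ler_wpM2r (ltW l_gt0)) H; apply: (le_trans H).
  by rewrite mulrAC ler_pdivrMr // mul1r /W lerDl.
split.
- exact: (glued_state_in_domA2 L p2 alpha_gt0 alpha_lt_beta beta_lt_l
    df df1 dg dg1 f_0 fg g_beta g1_beta stress_alpha).
- exact: (glued_state_in_H2 L lambda alpha_gt0 alpha_lt_beta beta_lt_l
    df dg f_0 fg g_beta).
- exact: (A2_glued_state_in_H2 L p2 alpha_gt0 alpha_lt_beta beta_lt_l
    df df1 dg dg1 f_0 fg g_beta g1_beta stress_alpha).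
- apply: (le_trans (norm_residual_glued_state L p2 alpha_gt0 alpha_lt_beta
    beta_lt_l df df1 dg dg1 f_0 fg g_beta g1_beta stress_alpha
    residual_left residual_mid)).
  by rewrite -[leRHS]sqrtr1 ler_wsqrtr.
- apply: (le_trans _ (norm_glued_state_ge L p1_gt0 p2_gt0 alpha_gt0
    alpha_lt_beta beta_lt_l df dg f_0 fg g_beta energy_left)).
  rewrite -sqrtrM; last by rewrite divr_ge0 ?mulr_ge0 // ltW.
  rewrite ler_wsqrtr // /kappa amp_sqr.
  rewrite le_eqVlt; apply/orP; left; apply/eqP.
  by field; rewrite !gt_eqF.
Qed.

End mode.

Lemma transmission_quasimodes : exists2 K : R, 0 < K &
  forall Lambda : R, exists lambda U,
    Lambda <= lambda /\ quasimode E N D A K lambda U.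
Proof.
exists (Num.sqrt (alpha / (4 * W))); first by rewrite sqrtr_gt0 divr_gt0 // mulr_gt0.
move=> Lambda.
(* The four bounds on lambda give, in order, lambda >= Lambda, lambda >= 1, k >= 1 and
   [lambda_large]. *)
pose M0 := Num.max (Num.max Lambda 1) (Num.max c1 (Cd * (3 * alpha ^+ 2 + 2) * 4)).
have pi2 : 0 < c1 * (2 * pi / alpha) by rewrite mulr_gt0 ?divr_gt0 ?mulr_gt0 ?pi_gt0.
have [n] : exists n : nat, M0 <= c1 * (2 * pi * n%:R / alpha).
  exists (Num.truncn (M0 / (c1 * (2 * pi / alpha)))).+1.
  have -> (r : R) : c1 * (2 * pi * r / alpha) = r * (c1 * (2 * pi / alpha)) by ring.
  by rewrite -ler_pdivrMr // ltW // truncnS_gt.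
rewrite !ge_max => /andP[/andP[h1 h2] /andP[h3 h4]].
(* Full periods, so that cos (k alpha) is 1 for every n rather than alternating in sign. *)
pose k := 2 * pi * n%:R / alpha; pose lambda := c1 * k.
have lambda0 : 0 < lambda by exact: lt_le_trans h2.
exists lambda; eexists; split; first exact: h1.
have k_alpha : k * alpha = 0 + pi *+ 2 *+ n.
  by rewrite add0r -mulr_natr -[pi *+ 2]mulr_natl /k divfK // gt_eqF.
apply: (@quasimode_mode k lambda (Num.sqrt (lambda / (2 * a)))) => //.
- rewrite sqr_sqrtr; last by rewrite divr_ge0 ?ltW // mulr_gt0.
  by rewrite mulrC divfK // mulf_neq0 // gt_eqF.
- by rewrite sqrtr_gt0 divr_gt0 // mulr_gt0.
- by move: h3; rewrite -[leLHS]mulr1 ler_pM2l.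
- by rewrite k_alpha (periodicn (@cosD2pi R)) cos0.
- by rewrite k_alpha (periodicn (@sinD2pi R)) sin0.
Qed.

End transmission_quasimodes.

Unset Implicit Arguments.

Theorem mainTheorem3 (R : realType) (l L p1 p2 a alpha beta : R)
    (l_gt0 : 0 < l) (l_lt_L : l < L)
    (p1_gt0 : 0 < p1) (p2_gt0 : 0 < p2) (a_gt0 : 0 < a)
    (alpha_beta : alpha = l - beta)
    (alpha_val : alpha = (L - l) * Num.sqrt p1 / Num.sqrt p2)
    (alpha_ge0 : 0 <= alpha) (alpha_lt_beta : alpha < beta)
    (beta_le_l : beta <= l) :
  let E := in_H2 l L in
  let N := norm_H2 l L p1 p2 in
  let D := domA2 l L p1 p2 a alpha beta in
  let A := A2 l L p1 p2 a alpha beta in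
  (* Lambda = 0 gives the supremum over all real lambda; arbitrary Lambda says
     that the unboundedness comes from large |lambda|, not from the
     singularity of |lambda|^(eps - 1/2) at 0 *)
  (forall eps : R, 0 < eps <= 2^-1 -> forall Lambda : R,
     ereal_sup [set ((`|lambda| `^ (eps - 2^-1))%R%:E
                     * opnorm N (resolvent_graph E N D A (0%R +i* lambda)%C))%E
               | lambda in [set lambda : R | Lambda <= `|lambda|]] = +oo%E) /\
  (forall T : R -> state R -> state R,
     contraction_C0_semigroup E N T -> generates E N D A T ->
     forall gamma : R, decay_estimate N D A T gamma -> gamma <= 2).
Proof.
move=> E N D A.
(* The wave lives on an undamped interval of positive length, supplied by [alpha_val]; then
   [alpha = l - beta] leaves a gap ]beta, l[ on which the state vanishes, so that the transmission
   conditions at [l] hold trivially. *)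
have alpha_gt0 : 0 < alpha.
  by rewrite alpha_val divr_gt0 ?mulr_gt0 ?sqrtr_gt0 // subr_gt0.
have beta_lt_l : beta < l by rewrite -subr_gt0 -alpha_beta.
have [K K_gt0 quasimodes] := @transmission_quasimodes R l L p1 p2 a alpha beta
  p1_gt0 p2_gt0 a_gt0 alpha_gt0 alpha_lt_beta beta_lt_l.
have E_lin : forall c U W, E U -> E W -> E (c *: U + W) by exact: in_H2ZD.
have NZ : forall c U, E U -> N (c *: U) = Num.sqrt (sqmod c) * N U.
  by move=> c U; exact: norm_H2Z.
have ND : forall U W, E U -> E W -> N (U + W) <= N U + N W.
  by move=> U W; exact: norm_H2D.
split.
  move=> eps /andP[eps0 _] Lambda.
  exact: (@resolvent_unbounded R (state R) E N E_lin NZ D A K K_gt0 quasimodes).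
move=> T cT gT gamma.
exact: (@decay_rate_le2 R (state R) E N E_lin NZ ND D A T cT gT K gamma K_gt0 quasimodes).
Qed.
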